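(* Let $\mathbb B$ be a double category. The following are equivalent. 1. There is a pseudodouble functor $\mathcal F:\mathbb B\to\mathrm{Pseudo}_{ps}(\mathbb B,\mathbb B)$. 2. There is a pseudodouble quasi-functor $H:\mathbb B\times\mathbb B\to\mathbb B$. 3. The following hold: (a) $\mathbb B$ is binoidal with pseudodouble functors $A\ltimes-,\,-\rtimes B:\mathbb B\to\mathbb B$ for $A,B\in\mathbb B$; (b) every 1h-cell $K$ is left central via a horizontal pseudonatural transformation $K\ltimes-$ and every 1h-cell $k$ is right central via a horizontal pseudonatural transformation $-\rtimes k$, and $A\ltimes-|_k=-\rtimes k|_A$, $-\rtimes B|_K=K\ltimes-|_B$; (c) every 1v-cell $U$ is left central via a vertical pseudonatural transformation $U\ltimes-$ and every 1v-cell $u$ is right central via a vertical pseudonatural transformation $-\rtimes u$, and $A\ltimes-|_u=-\rtimes u|_A$, $-\rtimes B|_U=U\ltimes-|_B$; (d) every 2-cell $\zeta$ is left central via a modification $\zeta\ltimes-$ and every 2-cell $\omega$ is right central via a modification $-\rtimes\omega$, and $A\ltimes-|_\omega=-\rtimes\omega|_A$, $-\rtimes B|_\zeta=\zeta\ltimes-|_B$; (e) $K\ltimes-|_k=(-\rtimes k|_K)^{-1}$, $U\ltimes-|_u=(-\rtimes u|_U)^{-1}$, $K\ltimes-|_u=-\rtimes u|_K$ and $U\ltimes-|_k=-\rtimes k|_U$ for all 1h-cells $K,k$ and 1v-cells $U,u$ in $\mathbb B$. In particular, in the situation of 3, the 2-cell component $K\ltimes-|_k$ of the oplax (resp. lax)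 structure of $K\ltimes-$ coincides with the 2-cell component at $K$ of the lax (resp. oplax) structure of $-\rtimes k$, and the 2-cell component $U\ltimes-|_u$ of the lax (resp. oplax) structure of $U\ltimes-$ coincides with the 2-cell component at $U$ of the oplax (resp. lax) structure of $-\rtimes u$.
   Context: Double categories are strict: objects, 1h-cells (horizontal), 1v-cells (vertical), squares (2-cells). $gf$: composite of 1h-cells ($f$ first). $[a|b]$: horizontal composition ($a$ left); $a/b$: vertical composition ($a$ on top), also for 1v-cells; iterated $a/b/c$ read downwards. $1_A,1^A$: horizontal/vertical identities; $\mathrm{Id}_f,\mathrm{Id}^u$: identity 2-cells. A 2-cell is horizontally (vertically) globular if its vertical (horizontal) sides are identities. A pseudodouble functor $F$ preserves vertical structure strictly and horizontal composition up to coherent natural invertible horizontally globular 2-cells $F_{gf}:F(g)F(f)\Rightarrow F(gf)$, $F_A:1_{F(A)}\Rightarrow F(1_A)$. A horizontal pseudonatural transformation $\alpha:F\Rightarrow G$: 1h-cells $\alpha(A)$; squares $\alpha^u$ (top $\alpha(A)$, bottom $\alpha(\tilde A)$, left $F(u)$, right $G(u)$) with $\alpha^{u/v}=\alpha^u/\alpha^v$, $\alpha^{1^A}=\mathrm{Id}$; invertible horizontally globular $\delta_{\alpha,f}:\alpha(B)F(f)\Rightarrow G(f)\alpha(A)$ (oplax structure; the inverses form the lax structure) compatible with compositors and unitors; and $[F(a)|\alpha^v]/\delta_{\alpha,g}=\delta_{\alpha,f}/[\alpha^u|G(a)]$ for each 2-cell $a$ with top $f$, bottom $g$, left $u$, right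 $v$. A vertical pseudonatural transformation $\alpha:F\Rightarrow G$: 1v-cells $\alpha(A)$; squares $\alpha_f$ (top $F(f)$, bottom $G(f)$, left $\alpha(A)$, right $\alpha(B)$) compatible with compositors and unitors; horizontally invertible vertically globular $\alpha^u$ with left side $\alpha(A)/G(u)$ and right side $F(u)/\alpha(\tilde A)$ (lax structure; inverses: oplax structure), compatible with vertical composition and identities; and $[\alpha^u|F(a)/\alpha_g]=[\alpha_f/G(a)|\alpha^v]$. A modification between horizontal $\alpha:F\Rightarrow G$, $\beta:F'\Rightarrow G'$ and vertical $\alpha_0:F\Rightarrow F'$, $\beta_0:G\Rightarrow G'$: squares $\Theta_A$ (top $\alpha(A)$, bottom $\beta(A)$, left $\alpha_0(A)$, right $\beta_0(A)$) with $[(\alpha_0)_f|\Theta_B]/\delta_{\beta,f}=\delta_{\alpha,f}/[\Theta_A|(\beta_0)_f]$ and $[\alpha_0^u|\alpha^u/\Theta_{\tilde A}]=[\Theta_A/\beta^u|\beta_0^u]$. $\mathrm{Pseudo}_{ps}(\mathbb B,\mathbb B)$ is the double category of pseudodouble functors $\mathbb B\to\mathbb B$, horizontal pseudonatural transformations (1h-cells), vertical pseudonatural transformations (1v-cells) and modifications. Binoidal: pseudodouble functors $A\ltimes-,-\rtimes B$ for all objects, with $A\ltimes B=A\rtimes B$. A 1h-cell (1v-cell) $p:A\to A'$ is left central if there is a horizontal (vertical) pseudonatural transformation $p\ltimes-:A\ltimes-\Rightarrow A'\ltimes-$ with $p\ltimes B=p\rtimes B$ for all $B$; right central if there is $-\rtimes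 p:-\rtimes A\Rightarrow-\rtimes A'$ with $B\rtimes p=B\ltimes p$. A 2-cell $a$ with left central sides is left central if the 2-cells $a\ltimes B:=a\rtimes B$ form a modification $a\ltimes-$; right central similarly. $p\ltimes-|_q$ denotes the component of $p\ltimes-$ at $q$: for $K:A\to A'$, $k:B\to B'$, $U:A\to\tilde A$, $u:B\to\tilde B$, $K\ltimes-|_k:(K\ltimes B')(A\ltimes k)\Rightarrow(A'\ltimes k)(K\ltimes B)$, $-\rtimes k|_K:(A'\rtimes k)(K\rtimes B)\Rightarrow(K\rtimes B')(A\rtimes k)$, $U\ltimes-|_u$ has left side $(A\ltimes u)/(U\ltimes\tilde B)$ and right side $(U\ltimes B)/(\tilde A\ltimes u)$, and $-\rtimes u|_U$ has left side $(U\rtimes B)/(\tilde A\rtimes u)$ and right side $(A\rtimes u)/(U\rtimes\tilde B)$. Pseudodouble quasi-functor $H:\mathbb A\times\mathbb B\to\mathbb C$: pseudodouble functors $H(A,-):\mathbb B\to\mathbb C$, $H(-,B):\mathbb A\to\mathbb C$ agreeing on objects, and for 1h-cells $K:A\to A'$, $k:B\to B'$ and 1v-cells $U:A\to\tilde A$, $u:B\to\tilde B$ ($K,U\in\mathbb A$; $k,u\in\mathbb B$) 2-cells: invertible horizontally globular $H(K,k):H(K,B')H(A,k)\Rightarrow H(A',k)H(K,B)$; squares $H(K,u)$ (top $H(K,B)$, bottom $H(K,\tilde B)$, left $H(A,u)$, right $H(A',u)$) and $H(U,k)$ (top $H(A,k)$, bottom $H(\tilde A,k)$, left $H(U,B)$,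 right $H(U,B')$); horizontally invertible vertically globular $H(U,u)$ (left $H(U,B)/H(\tilde A,u)$, right $H(A,u)/H(U,\tilde B)$); satisfying 20 axioms: $[H(A,-)_B|\mathrm{Id}]/H(K,1_B)=[\mathrm{Id}|H(A',-)_B]$; $[\mathrm{Id}|H(-,B')_A]/H(1_A,k)=[H(-,B)_A|\mathrm{Id}]$; $H(-,B)_A/H(1_A,u)=\mathrm{Id}^{H(A,u)}/H(-,\tilde B)_A$; $H(A,-)_B/H(U,1_B)=\mathrm{Id}^{H(U,B)}/H(\tilde A,-)_B$; $H(K,1^B)$, $H(1^A,k)$, $H(U,1^B)$, $H(1^A,u)$ are identities; $[\mathrm{Id}_{H(A,k)}|H(K,k')]/[H(K,k)|\mathrm{Id}]/[\mathrm{Id}|H(A',-)_{k'k}]=[H(A,-)_{k'k}|\mathrm{Id}]/H(K,k'k)$; $[\mathrm{Id}|H(-,B')_{K'K}]/H(K'K,k)=[H(K,k)|\mathrm{Id}]/[\mathrm{Id}|H(K',k)]/[H(-,B)_{K'K}|\mathrm{Id}]$; $H(-,B)_{K'K}/H(K'K,u)=[H(K,u)|H(K',u)]/H(-,\tilde B)_{K'K}$; $H(A,-)_{k'k}/H(U,k'k)=[H(U,k)|H(U,k')]/H(\tilde A,-)_{k'k}$; $H(K,u/u')=H(K,u)/H(K,u')$; $H(U/U',k)=H(U,k)/H(U',k)$; $H(U/U',u)=[\mathrm{Id}^{H(U,B)}/H(U',u)\,|\,H(U,u)/\mathrm{Id}^{H(U',\tilde B)}]$; $H(U,u/u')=[H(U,u)/\mathrm{Id}^{H(\tilde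 A,u')}\,|\,\mathrm{Id}^{H(A,u)}/H(U,u')]$; and for 2-cells $\omega\in\mathbb B$ (top $k$, bottom $l$, left $u$, right $v$), $\zeta\in\mathbb A$ (top $K$, bottom $L$, left $U$, right $V$): $H(K,k)/[H(K,u)|H(A',\omega)]=[H(A,\omega)|H(K,v)]/H(K,l)$; $H(K,k)/[H(\zeta,B)|H(V,k)]=[H(U,k)|H(\zeta,B')]/H(L,k)$; $[H(U,u)|H(A,\omega)/H(U,l)]=[H(U,k)/H(\tilde A,\omega)|H(U,v)]$; $[H(U,u)|H(K,u)/H(\zeta,\tilde B)]=[H(\zeta,B)/H(L,u)|H(V,u)]$. *)

(* Defs.v *)
From mathcomp Require Import ssreflect ssrfun ssrbool.
From mathcomp Require Import boolp.

Set Implicit Arguments.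
Unset Strict Implicit.
Unset Printing Implicit Defensive.

Declare Scope dbl_scope.
Local Open Scope dbl_scope.

Reserved Notation "g \oh f" (at level 40, left associativity).
Reserved Notation "u \ov v" (at level 40, left associativity).
Reserved Notation "a <|> b" (at level 45, left associativity).
Reserved Notation "a </> b" (at level 48, left associativity).

(* Strict double categories, presented by four types of cells with boundary
   maps.  The four compositions are total functions of which only the values on
   composable pairs matter: every law carries its composability hypotheses.
   This keeps all equations between cells homogeneous although the boundaries
   only agree up to the (strict) associativity and unit laws.
     g \oh f = the composite 1h-cell gf, f first;
     u \ov v = the composite 1v-cell u/v, u on top;
     a <|> b = [a|b], a on the left;     a </> b = a/b, a on top;
     hid A = 1_A,  vid A = 1^A,  idh f = Id_f,  idv u = Id^u. *)
Record dblCat := DblCat {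
  Ob : Type;
  Hor : Type;
  Ver : Type;
  Sq : Type;
  hdom : Hor -> Ob;
  hcod : Hor -> Ob;
  vdom : Ver -> Ob;
  vcod : Ver -> Ob;
  top : Sq -> Hor;
  bot : Sq -> Hor;
  lft : Sq -> Ver;
  rgt : Sq -> Ver;
  hid : Ob -> Hor;
  vid : Ob -> Ver;
  idh : Hor -> Sq;
  idv : Ver -> Sq;
  hcmp : Hor -> Hor -> Hor where "g \oh f" := (hcmp g f);
  vcmp : Ver -> Ver -> Ver where "u \ov v" := (vcmp u v);
  hsq : Sq -> Sq -> Sq where "a <|> b" := (hsq a b);
  vsq : Sq -> Sq -> Sq where "a </> b" := (vsq a b);
  hdom_top : forall a, hdom (top a) = vdom (lft a);
  hcod_top : forall a, hcod (top a) = vdom (rgt a);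
  hdom_bot : forall a, hdom (bot a) = vcod (lft a);
  hcod_bot : forall a, hcod (bot a) = vcod (rgt a);
  hdom_hid : forall A, hdom (hid A) = A;
  hcod_hid : forall A, hcod (hid A) = A;
  hdom_hcmp : forall f g, hcod f = hdom g -> hdom (g \oh f) = hdom f;
  hcod_hcmp : forall f g, hcod f = hdom g -> hcod (g \oh f) = hcod g;
  hcmp1 : forall f, f \oh hid (hdom f) = f;
  hcmp1l : forall f, hid (hcod f) \oh f = f;
  hcmpA : forall f g h, hcod f = hdom g -> hcod g = hdom h ->
    h \oh (g \oh f) = h \oh g \oh f;
  vdom_vid : forall A, vdom (vid A) = A;
  vcod_vid : forall A, vcod (vid A) = A;
  vdom_vcmp : forall u v, vcod u = vdom v -> vdom (u \ov v) = vdom u;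
  vcod_vcmp : forall u v, vcod u = vdom v -> vcod (u \ov v) = vcod v;
  vcmp1l : forall u, vid (vdom u) \ov u = u;
  vcmp1 : forall u, u \ov vid (vcod u) = u;
  vcmpA : forall u v w, vcod u = vdom v -> vcod v = vdom w ->
    u \ov (v \ov w) = u \ov v \ov w;
  top_idh : forall f, top (idh f) = f;
  bot_idh : forall f, bot (idh f) = f;
  lft_idh : forall f, lft (idh f) = vid (hdom f);
  rgt_idh : forall f, rgt (idh f) = vid (hcod f);
  top_idv : forall u, top (idv u) = hid (vdom u);
  bot_idv : forall u, bot (idv u) = hid (vcod u);
  lft_idv : forall u, lft (idv u) = u;
  rgt_idv : forall u, rgt (idv u) = u;
  top_hsq : forall a b, rgt a = lft b -> top (a <|> b) = top b \oh top a;
  bot_hsq : forall a b, rgt a = lft b -> bot (a <|> b) = bot b \oh bot a;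
  lft_hsq : forall a b, rgt a = lft b -> lft (a <|> b) = lft a;
  rgt_hsq : forall a b, rgt a = lft b -> rgt (a <|> b) = rgt b;
  top_vsq : forall a b, bot a = top b -> top (a </> b) = top a;
  bot_vsq : forall a b, bot a = top b -> bot (a </> b) = bot b;
  lft_vsq : forall a b, bot a = top b -> lft (a </> b) = lft a \ov lft b;
  rgt_vsq : forall a b, bot a = top b -> rgt (a </> b) = rgt a \ov rgt b;
  hsq1l : forall a, idv (lft a) <|> a = a;
  hsq1 : forall a, a <|> idv (rgt a) = a;
  hsqA : forall a b c, rgt a = lft b -> rgt b = lft c ->
    a <|> (b <|> c) = a <|> b <|> c;
  vsq1l : forall a, idh (top a) </> a = a;
  vsq1 : forall a, a </> idh (bot a) = a;
  vsqA : forall a b c, bot a = top b -> bot b = top c ->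
    a </> (b </> c) = a </> b </> c;
  sq_interchange : forall a b c d,
    rgt a = lft b -> rgt c = lft d -> bot a = top c -> bot b = top d ->
    (a <|> b) </> (c <|> d) = (a </> c) <|> (b </> d);
  idh_hid : forall A, idh (hid A) = idv (vid A);
  idh_hcmp : forall f g, hcod f = hdom g -> idh (g \oh f) = idh f <|> idh g;
  idv_vcmp : forall u v, vcod u = vdom v -> idv (u \ov v) = idv u </> idv v
}.

Notation "g \oh f" := (hcmp g f) : dbl_scope.
Notation "u \ov v" := (vcmp u v) : dbl_scope.
Notation "a <|> b" := (hsq a b) : dbl_scope.
Notation "a </> b" := (vsq a b) : dbl_scope.

Arguments hid {_}.
Arguments vid {_}.

Section Inverses.
Variable D : dblCat.
Implicit Types a b : Sq D.

Definition hglobular a :=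
  lft a = vid (hdom (top a)) /\ rgt a = vid (hcod (top a)).

Definition vglobular a :=
  top a = hid (vdom (lft a)) /\ bot a = hid (vcod (lft a)).

Definition vinverse a b :=
  [/\ bot a = top b, bot b = top a, a </> b = idh (top a)
    & b </> a = idh (top b)].

Definition hinverse a b :=
  [/\ rgt a = lft b, rgt b = lft a, a <|> b = idv (lft a)
    & b <|> a = idv (lft b)].

Definition vinvertible a := exists b, vinverse a b.
Definition hinvertible a := exists b, hinverse a b.

(* The inverse of an invertible square; the default value is irrelevant. *)
Definition vinv a : Sq D :=
  if pselect (vinvertible a) is left h then projT1 (cid h) else a.

Definition hinv a : Sq D :=
  if pselect (hinvertible a) is left h then projT1 (cid h) else a.

End Inverses.

(* The compositor takes a proof of composability, so that a functor carries no
   data outside composable pairs. *)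
Record psFunctor (A B : dblCat) := PsFunctor {
  fob : Ob A -> Ob B;
  fhor : Hor A -> Hor B;
  fver : Ver A -> Ver B;
  fsq : Sq A -> Sq B;
  fcmp : forall g f : Hor A, hcod f = hdom g -> Sq B;
  funt : Ob A -> Sq B;
  hdom_fhor : forall f, hdom (fhor f) = fob (hdom f);
  hcod_fhor : forall f, hcod (fhor f) = fob (hcod f);
  vdom_fver : forall u, vdom (fver u) = fob (vdom u);
  vcod_fver : forall u, vcod (fver u) = fob (vcod u);
  top_fsq : forall a, top (fsq a) = fhor (top a);
  bot_fsq : forall a, bot (fsq a) = fhor (bot a);
  lft_fsq : forall a, lft (fsq a) = fver (lft a);
  rgt_fsq : forall a, rgt (fsq a) = fver (rgt a);
  fver_vid : forall X, fver (vid X) = vid (fob X);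
  fver_vcmp : forall u v, vcod u = vdom v ->
    fver (u \ov v) = fver u \ov fver v;
  fsq_idh : forall f, fsq (idh f) = idh (fhor f);
  fsq_vsq : forall a b, bot a = top b -> fsq (a </> b) = fsq a </> fsq b;
  top_fcmp : forall g f (e : hcod f = hdom g),
    top (fcmp e) = fhor g \oh fhor f;
  bot_fcmp : forall g f (e : hcod f = hdom g), bot (fcmp e) = fhor (g \oh f);
  lft_fcmp : forall g f (e : hcod f = hdom g),
    lft (fcmp e) = vid (fob (hdom f));
  rgt_fcmp : forall g f (e : hcod f = hdom g),
    rgt (fcmp e) = vid (fob (hcod g));
  fcmp_inv : forall g f (e : hcod f = hdom g), vinvertible (fcmp e);
  top_funt : forall X, top (funt X) = hid (fob X);
  bot_funt : forall X, bot (funt X) = fhor (hid X);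
  lft_funt : forall X, lft (funt X) = vid (fob X);
  rgt_funt : forall X, rgt (funt X) = vid (fob X);
  funt_inv : forall X, vinvertible (funt X);
  fcmp_nat : forall a b (e : hcod (top a) = hdom (top b))
      (e' : hcod (bot a) = hdom (bot b)), rgt a = lft b ->
    (fsq a <|> fsq b) </> fcmp e' = fcmp e </> fsq (a <|> b);
  funt_nat : forall u,
    funt (vdom u) </> fsq (idv u) = idv (fver u) </> funt (vcod u);
  fcmpA : forall f g h (e : hcod f = hdom g) (e' : hcod g = hdom h)
      (e1 : hcod (g \oh f) = hdom h) (e2 : hcod f = hdom (h \oh g)),
    (fcmp e <|> idh (fhor h)) </> fcmp e1 =
    (idh (fhor f) <|> fcmp e') </> fcmp e2;
  fcmp1 : forall f (e : hcod (hid (hdom f)) = hdom f),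
    (funt (hdom f) <|> idh (fhor f)) </> fcmp e = idh (fhor f);
  fcmp1l : forall f (e : hcod f = hdom (hid (hcod f))),
    (idh (fhor f) <|> funt (hcod f)) </> fcmp e = idh (fhor f)
}.

Arguments fcmp {A B} p {g f} e.

(* Components alpha(A), alpha^u and delta_{alpha,f}. *)
Record hTransData (A B : dblCat) := HTransData {
  hc : Ob A -> Hor B;
  hv : Ver A -> Sq B;
  hd : Hor A -> Sq B
}.

Record isHTrans (A B : dblCat) (F G : psFunctor A B) (al : hTransData A B) :
    Prop := IsHTrans {
  hdom_hc : forall X, hdom (hc al X) = fob F X;
  hcod_hc : forall X, hcod (hc al X) = fob G X;
  top_hv : forall u, top (hv al u) = hc al (vdom u);
  bot_hv : forall u, bot (hv al u) = hc al (vcod u);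
  lft_hv : forall u, lft (hv al u) = fver F u;
  rgt_hv : forall u, rgt (hv al u) = fver G u;
  hv_vcmp : forall u v, vcod u = vdom v ->
    hv al (u \ov v) = hv al u </> hv al v;
  hv_vid : forall X, hv al (vid X) = idh (hc al X);
  top_hd : forall f, top (hd al f) = hc al (hcod f) \oh fhor F f;
  bot_hd : forall f, bot (hd al f) = fhor G f \oh hc al (hdom f);
  lft_hd : forall f, lft (hd al f) = vid (fob F (hdom f));
  rgt_hd : forall f, rgt (hd al f) = vid (fob G (hcod f));
  hd_inv : forall f, vinvertible (hd al f);
  hd_hcmp : forall g f (e : hcod f = hdom g),
    (fcmp F e <|> idh (hc al (hcod g))) </> hd al (g \oh f) =
    (idh (fhor F f) <|> hd al g) </> (hd al f <|> idh (fhor G g))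
      </> (idh (hc al (hdom f)) <|> fcmp G e);
  hd_hid : forall X,
    (funt F X <|> idh (hc al X)) </> hd al (hid X) =
    idh (hc al X) <|> funt G X;
  hd_nat : forall a,
    (fsq F a <|> hv al (rgt a)) </> hd al (bot a) =
    hd al (top a) </> (hv al (lft a) <|> fsq G a)
}.

Definition hoplax A B (al : hTransData A B) (f : Hor A) : Sq B := hd al f.
Definition hlax A B (al : hTransData A B) (f : Hor A) : Sq B := vinv (hd al f).

(* Components alpha(A), alpha_f and alpha^u. *)
Record vTransData (A B : dblCat) := VTransData {
  vc : Ob A -> Ver B;
  vh : Hor A -> Sq B;
  vd : Ver A -> Sq B
}.

Record isVTrans (A B : dblCat) (F G : psFunctor A B) (al : vTransData A B) :
    Prop := IsVTrans {
  vdom_vc : forall X, vdom (vc al X) = fob F X;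
  vcod_vc : forall X, vcod (vc al X) = fob G X;
  top_vh : forall f, top (vh al f) = fhor F f;
  bot_vh : forall f, bot (vh al f) = fhor G f;
  lft_vh : forall f, lft (vh al f) = vc al (hdom f);
  rgt_vh : forall f, rgt (vh al f) = vc al (hcod f);
  vh_hcmp : forall g f (e : hcod f = hdom g),
    fcmp F e </> vh al (g \oh f) = (vh al f <|> vh al g) </> fcmp G e;
  vh_hid : forall X,
    funt F X </> vh al (hid X) = idv (vc al X) </> funt G X;
  top_vd : forall u, top (vd al u) = hid (fob F (vdom u));
  bot_vd : forall u, bot (vd al u) = hid (fob G (vcod u));
  lft_vd : forall u, lft (vd al u) = vc al (vdom u) \ov fver G u;
  rgt_vd : forall u, rgt (vd al u) = fver F u \ov vc al (vcod u);
  vd_inv : forall u, hinvertible (vd al u);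
  vd_vcmp : forall u v, vcod u = vdom v ->
    vd al (u \ov v) =
    (vd al u </> idv (fver G v)) <|> (idv (fver F u) </> vd al v);
  vd_vid : forall X, vd al (vid X) = idv (vc al X);
  vd_nat : forall a,
    vd al (lft a) <|> (fsq F a </> vh al (bot a)) =
    (vh al (top a) </> fsq G a) <|> vd al (rgt a)
}.

Definition vlax A B (al : vTransData A B) (u : Ver A) : Sq B := vd al u.
Definition voplax A B (al : vTransData A B) (u : Ver A) : Sq B :=
  hinv (vd al u).

Record isModif (A B : dblCat) (al be : hTransData A B)
    (al0 be0 : vTransData A B) (th : Ob A -> Sq B) : Prop := IsModif {
  top_mod : forall X, top (th X) = hc al X;
  bot_mod : forall X, bot (th X) = hc be X;
  lft_mod : forall X, lft (th X) = vc al0 X;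
  rgt_mod : forall X, rgt (th X) = vc be0 X;
  mod_hor : forall f,
    (vh al0 f <|> th (hcod f)) </> hd be f =
    hd al f </> (th (hdom f) <|> vh be0 f);
  mod_ver : forall u,
    vd al0 u <|> (hv al u </> th (vcod u)) =
    (th (vdom u) </> hv be u) <|> vd be0 u
}.

Record hTrans (A B : dblCat) := HTrans {
  hsrc : psFunctor A B;
  htgt : psFunctor A B;
  hdat :> hTransData A B;
  hTransP : isHTrans hsrc htgt hdat
}.

Record vTrans (A B : dblCat) := VTrans {
  vsrc : psFunctor A B;
  vtgt : psFunctor A B;
  vdat :> vTransData A B;
  vTransP : isVTrans vsrc vtgt vdat
}.

Record modif (A B : dblCat) := Modif {
  mtop : hTrans A B;
  mbot : hTrans A B;
  mlft : vTrans A B;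
  mrgt : vTrans A B;
  mdat :> Ob A -> Sq B;
  m_tl : hsrc mtop = vsrc mlft;
  m_tr : htgt mtop = vsrc mrgt;
  m_bl : hsrc mbot = vtgt mlft;
  m_br : htgt mbot = vtgt mrgt;
  modifP : isModif mtop mbot mlft mrgt mdat
}.

Section UnitLemmas.
Variable D : dblCat.

Lemma hcmp1E (f : Hor D) X : hdom f = X -> f \oh hid X = f.
Proof. by move=> <-; apply: hcmp1. Qed.
Lemma hcmp1lE (f : Hor D) X : hcod f = X -> hid X \oh f = f.
Proof. by move=> <-; apply: hcmp1l. Qed.
Lemma vcmp1E (u : Ver D) X : vcod u = X -> u \ov vid X = u.
Proof. by move=> <-; apply: vcmp1. Qed.
Lemma vcmp1lE (u : Ver D) X : vdom u = X -> vid X \ov u = u.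
Proof. by move=> <-; apply: vcmp1l. Qed.
Lemma hsq1E (a : Sq D) u : rgt a = u -> a <|> idv u = a.
Proof. by move=> <-; apply: hsq1. Qed.
Lemma hsq1lE (a : Sq D) u : lft a = u -> idv u <|> a = a.
Proof. by move=> <-; apply: hsq1l. Qed.
Lemma vsq1E (a : Sq D) f : bot a = f -> a </> idh f = a.
Proof. by move=> <-; apply: vsq1. Qed.
Lemma vsq1lE (a : Sq D) f : top a = f -> idh f </> a = a.
Proof. by move=> <-; apply: vsq1l. Qed.

End UnitLemmas.

Ltac bd_step tac :=
  match goal with
  | H : isHTrans _ _ ?al |- context [hdom (hc ?al ?X)] => rewrite (hdom_hc H X)
  | H : isHTrans _ _ ?al |- context [hcod (hc ?al ?X)] => rewrite (hcod_hc H X)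
  | H : isHTrans _ _ ?al |- context [top (hv ?al ?u)] => rewrite (top_hv H u)
  | H : isHTrans _ _ ?al |- context [bot (hv ?al ?u)] => rewrite (bot_hv H u)
  | H : isHTrans _ _ ?al |- context [lft (hv ?al ?u)] => rewrite (lft_hv H u)
  | H : isHTrans _ _ ?al |- context [rgt (hv ?al ?u)] => rewrite (rgt_hv H u)
  | H : isHTrans _ _ ?al |- context [top (hd ?al ?f)] => rewrite (top_hd H f)
  | H : isHTrans _ _ ?al |- context [bot (hd ?al ?f)] => rewrite (bot_hd H f)
  | H : isHTrans _ _ ?al |- context [lft (hd ?al ?f)] => rewrite (lft_hd H f)
  | H : isHTrans _ _ ?al |- context [rgt (hd ?al ?f)] => rewrite (rgt_hd H f)
  | H : isVTrans _ _ ?al |- context [vdom (vc ?al ?X)] => rewrite (vdom_vc H X)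
  | H : isVTrans _ _ ?al |- context [vcod (vc ?al ?X)] => rewrite (vcod_vc H X)
  | H : isVTrans _ _ ?al |- context [top (vh ?al ?f)] => rewrite (top_vh H f)
  | H : isVTrans _ _ ?al |- context [bot (vh ?al ?f)] => rewrite (bot_vh H f)
  | H : isVTrans _ _ ?al |- context [lft (vh ?al ?f)] => rewrite (lft_vh H f)
  | H : isVTrans _ _ ?al |- context [rgt (vh ?al ?f)] => rewrite (rgt_vh H f)
  | H : isVTrans _ _ ?al |- context [top (vd ?al ?u)] => rewrite (top_vd H u)
  | H : isVTrans _ _ ?al |- context [bot (vd ?al ?u)] => rewrite (bot_vd H u)
  | H : isVTrans _ _ ?al |- context [lft (vd ?al ?u)] => rewrite (lft_vd H u)
  | H : isVTrans _ _ ?al |- context [rgt (vd ?al ?u)] => rewrite (rgt_vd H u)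
  | H : isModif _ _ _ _ ?th |- context [top (?th ?X)] => rewrite (top_mod H X)
  | H : isModif _ _ _ _ ?th |- context [bot (?th ?X)] => rewrite (bot_mod H X)
  | H : isModif _ _ _ _ ?th |- context [lft (?th ?X)] => rewrite (lft_mod H X)
  | H : isModif _ _ _ _ ?th |- context [rgt (?th ?X)] => rewrite (rgt_mod H X)
  | |- context [hdom (fhor ?F ?f)] => rewrite (hdom_fhor F f)
  | |- context [hcod (fhor ?F ?f)] => rewrite (hcod_fhor F f)
  | |- context [vdom (fver ?F ?f)] => rewrite (vdom_fver F f)
  | |- context [vcod (fver ?F ?f)] => rewrite (vcod_fver F f)
  | |- context [top (fsq ?F ?f)] => rewrite (top_fsq F f)
  | |- context [bot (fsq ?F ?f)] => rewrite (bot_fsq F f)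
  | |- context [lft (fsq ?F ?f)] => rewrite (lft_fsq F f)
  | |- context [rgt (fsq ?F ?f)] => rewrite (rgt_fsq F f)
  | |- context [top (fcmp ?F ?e)] => rewrite (top_fcmp F e)
  | |- context [bot (fcmp ?F ?e)] => rewrite (bot_fcmp F e)
  | |- context [lft (fcmp ?F ?e)] => rewrite (lft_fcmp F e)
  | |- context [rgt (fcmp ?F ?e)] => rewrite (rgt_fcmp F e)
  | |- context [top (funt ?F ?e)] => rewrite (top_funt F e)
  | |- context [bot (funt ?F ?e)] => rewrite (bot_funt F e)
  | |- context [lft (funt ?F ?e)] => rewrite (lft_funt F e)
  | |- context [rgt (funt ?F ?e)] => rewrite (rgt_funt F e)
  | |- context [fver ?F (vid ?X)] => rewrite (fver_vid F X)
  | |- context [top (idh ?f)] => rewrite (top_idh f)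
  | |- context [bot (idh ?f)] => rewrite (bot_idh f)
  | |- context [lft (idh ?f)] => rewrite (lft_idh f)
  | |- context [rgt (idh ?f)] => rewrite (rgt_idh f)
  | |- context [top (idv ?f)] => rewrite (top_idv f)
  | |- context [bot (idv ?f)] => rewrite (bot_idv f)
  | |- context [lft (idv ?f)] => rewrite (lft_idv f)
  | |- context [rgt (idv ?f)] => rewrite (rgt_idv f)
  | |- context [hdom (hid ?X)] => rewrite (hdom_hid X)
  | |- context [hcod (hid ?X)] => rewrite (hcod_hid X)
  | |- context [vdom (vid ?X)] => rewrite (vdom_vid X)
  | |- context [vcod (vid ?X)] => rewrite (vcod_vid X)
  | |- context [hdom (?g \oh ?f)] => rewrite (@hdom_hcmp _ f g); [|solve [tac]]
  | |- context [hcod (?g \oh ?f)] => rewrite (@hcod_hcmp _ f g); [|solve [tac]]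
  | |- context [vdom (?g \ov ?f)] => rewrite (@vdom_vcmp _ g f); [|solve [tac]]
  | |- context [vcod (?g \ov ?f)] => rewrite (@vcod_vcmp _ g f); [|solve [tac]]
  | |- context [top (?a <|> ?b)] => rewrite (@top_hsq _ a b); [|solve [tac]]
  | |- context [bot (?a <|> ?b)] => rewrite (@bot_hsq _ a b); [|solve [tac]]
  | |- context [lft (?a <|> ?b)] => rewrite (@lft_hsq _ a b); [|solve [tac]]
  | |- context [rgt (?a <|> ?b)] => rewrite (@rgt_hsq _ a b); [|solve [tac]]
  | |- context [top (?a </> ?b)] => rewrite (@top_vsq _ a b); [|solve [tac]]
  | |- context [bot (?a </> ?b)] => rewrite (@bot_vsq _ a b); [|solve [tac]]
  | |- context [lft (?a </> ?b)] => rewrite (@lft_vsq _ a b); [|solve [tac]]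
  | |- context [rgt (?a </> ?b)] => rewrite (@rgt_vsq _ a b); [|solve [tac]]
  | |- context [?f \oh hid ?X] => rewrite (@hcmp1E _ f X); [|solve [tac]]
  | |- context [hid ?X \oh ?f] => rewrite (@hcmp1lE _ f X); [|solve [tac]]
  | |- context [?f \ov vid ?X] => rewrite (@vcmp1E _ f X); [|solve [tac]]
  | |- context [vid ?X \ov ?f] => rewrite (@vcmp1lE _ f X); [|solve [tac]]
  | |- context [?h \oh (?g \oh ?f)] =>
      rewrite (@hcmpA _ f g h); [|solve [tac]|solve [tac]]
  | |- context [?u \ov (?v \ov ?w)] =>
      rewrite (@vcmpA _ u v w); [|solve [tac]|solve [tac]]
  | H : lft ?a = vid ?X |- context [vdom (lft ?a)] =>
      lazymatch X with context [a] => fail | _ => rewrite H end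
  | H : lft ?a = vid ?X |- context [vcod (lft ?a)] =>
      lazymatch X with context [a] => fail | _ => rewrite H end
  | H : rgt ?a = vid ?X |- context [vdom (rgt ?a)] =>
      lazymatch X with context [a] => fail | _ => rewrite H end
  | H : rgt ?a = vid ?X |- context [vcod (rgt ?a)] =>
      lazymatch X with context [a] => fail | _ => rewrite H end
  | H : top ?a = hid ?X |- context [hdom (top ?a)] =>
      lazymatch X with context [a] => fail | _ => rewrite H end
  | H : top ?a = hid ?X |- context [hcod (top ?a)] =>
      lazymatch X with context [a] => fail | _ => rewrite H end
  | H : bot ?a = hid ?X |- context [hdom (bot ?a)] =>
      lazymatch X with context [a] => fail | _ => rewrite H end
  | H : bot ?a = hid ?X |- context [hcod (bot ?a)] =>
      lazymatch X with context [a] => fail | _ => rewrite H end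
  | |- context [hdom (top ?a)] => rewrite (hdom_top a)
  | |- context [hcod (top ?a)] => rewrite (hcod_top a)
  | |- context [hdom (bot ?a)] => rewrite (hdom_bot a)
  | |- context [hcod (bot ?a)] => rewrite (hcod_bot a)
  end.
Ltac bd :=
  intros;
  first [ solve [reflexivity | assumption | congruence]
        | repeat (bd_step bd); solve [reflexivity | assumption | congruence] ].

Section Whisker.
Variable D : dblCat.
Implicit Types a b : Sq D.

Lemma wr a b (f : Hor D) : bot a = top b ->
  rgt a = vid (hdom f) -> rgt b = vid (hdom f) ->
  (a </> b) <|> idh f = (a <|> idh f) </> (b <|> idh f).
Proof.
move=> e ea eb; rewrite sq_interchange; [|bd..].
by congr (_ <|> _); rewrite vsq1E //; bd.
Qed.

Lemma wl a b (f : Hor D) : bot a = top b ->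
  lft a = vid (hcod f) -> lft b = vid (hcod f) ->
  idh f <|> (a </> b) = (idh f <|> a) </> (idh f <|> b).
Proof.
move=> e ea eb; rewrite sq_interchange; [|bd..].
by congr (_ <|> _); rewrite vsq1E //; bd.
Qed.

Lemma wd a b (u : Ver D) : rgt a = lft b ->
  bot a = hid (vdom u) -> bot b = hid (vdom u) ->
  (a <|> b) </> idv u = (a </> idv u) <|> (b </> idv u).
Proof.
move=> e ea eb; rewrite -sq_interchange; [|bd..].
by congr (_ </> _); rewrite hsq1E //; bd.
Qed.

Lemma wu a b (u : Ver D) : rgt a = lft b ->
  top a = hid (vcod u) -> top b = hid (vcod u) ->
  idv u </> (a <|> b) = (idv u </> a) <|> (idv u </> b).
Proof.
move=> e ea eb; rewrite -sq_interchange; [|bd..].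
by congr (_ </> _); rewrite hsq1E //; bd.
Qed.

Lemma slide_h a b : rgt a = lft b -> lft b = vid (vdom (lft b)) ->
  (a <|> idh (top b)) </> (idh (bot a) <|> b) = a <|> b.
Proof.
move=> e ea.
have e1 : lft b = vid (vcod (lft b)) by rewrite ea; bd.
rewrite sq_interchange; [|bd..].
by rewrite vsq1 vsq1l.
Qed.

Lemma slide_h' a b : rgt a = lft b -> lft b = vid (vdom (lft b)) ->
  (idh (top a) <|> b) </> (a <|> idh (bot b)) = a <|> b.
Proof.
move=> e ea.
have e1 : lft b = vid (vcod (lft b)) by rewrite ea; bd.
rewrite sq_interchange; [|bd..].
by rewrite vsq1 vsq1l.
Qed.

Lemma slide_v a b : bot a = top b -> bot a = hid (hdom (bot a)) ->
  (a </> idv (lft b)) <|> (idv (rgt a) </> b) = a </> b.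
Proof.
move=> e ea.
have e1 : bot a = hid (hcod (bot a)) by rewrite ea; bd.
have e2 : bot a = hid (vdom (lft b)) by rewrite -hdom_top -e.
have e3 : hid (vcod (rgt a)) = top b by rewrite -hcod_bot -e -e1.
have e4 : hid (vdom (rgt b)) = top b by rewrite -hcod_top -e -e1.
have e5 : bot a = hid (vcod (lft a)) by rewrite -hdom_bot.
rewrite -sq_interchange; [|bd..].
by rewrite hsq1 hsq1l.
Qed.

Lemma slide_v' a b : bot a = top b -> bot a = hid (hdom (bot a)) ->
  (idv (lft a) </> b) <|> (a </> idv (rgt b)) = a </> b.
Proof.
move=> e ea.
have e1 : bot a = hid (hcod (bot a)) by rewrite ea; bd.
have e2 : bot a = hid (vdom (lft b)) by rewrite -hdom_top -e.
have e3 : hid (vcod (rgt a)) = top b by rewrite -hcod_bot -e -e1.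
have e4 : hid (vdom (rgt b)) = top b by rewrite -hcod_top -e -e1.
have e5 : bot a = hid (vcod (lft a)) by rewrite -hdom_bot.
rewrite -sq_interchange; [|bd..].
by rewrite hsq1 hsq1l.
Qed.

Lemma vinvertible_vsq a b : bot a = top b -> vinvertible a -> vinvertible b ->
  vinvertible (a </> b).
Proof.
move=> e [a' [ea1 ea2 ea3 ea4]] [b' [eb1 eb2 eb3 eb4]].
exists (b' </> a'); split; [bd|bd| |].
- rewrite vsqA; [|bd..]; rewrite -(vsqA (a := a)); [|bd..].
  by rewrite eb3 vsq1E ?ea3; bd.
- rewrite vsqA; [|bd..]; rewrite -(vsqA (a := b')); [|bd..].
  by rewrite ea4 vsq1E ?eb4; bd.
Qed.

Lemma hinvertible_hsq a b : rgt a = lft b -> hinvertible a -> hinvertible b ->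
  hinvertible (a <|> b).
Proof.
move=> e [a' [ea1 ea2 ea3 ea4]] [b' [eb1 eb2 eb3 eb4]].
exists (b' <|> a'); split; [bd|bd| |].
- rewrite hsqA; [|bd..]; rewrite -(hsqA (a := a)); [|bd..].
  by rewrite eb3 hsq1E ?ea3; bd.
- rewrite hsqA; [|bd..]; rewrite -(hsqA (a := b')); [|bd..].
  by rewrite ea4 hsq1E ?eb4; bd.
Qed.

Lemma vinverse_lft a b X : vinverse a b -> lft a = vid X -> lft b = vid X.
Proof.
move=> [e1 e2 e3 e4] ea.
have := congr1 (@lft D) e3; rewrite lft_vsq // ea.
have E : vdom (lft b) = X by rewrite -hdom_top -e1 hdom_bot ea; bd.
by rewrite vcmp1lE // => ->; rewrite lft_idh hdom_top ea vdom_vid.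
Qed.

Lemma vinverse_rgt a b X : vinverse a b -> rgt a = vid X -> rgt b = vid X.
Proof.
move=> [e1 e2 e3 e4] ea.
have := congr1 (@rgt D) e3; rewrite rgt_vsq // ea.
have E : vdom (rgt b) = X by rewrite -hcod_top -e1 hcod_bot ea; bd.
by rewrite vcmp1lE // => ->; rewrite rgt_idh hcod_top ea vdom_vid.
Qed.

Lemma hinverse_top a b X : hinverse a b -> top a = hid X -> top b = hid X.
Proof.
move=> [e1 e2 e3 e4] ea.
have := congr1 (@top D) e3; rewrite top_hsq // ea.
have E : hdom (top b) = X by rewrite hdom_top -e1 -hcod_top ea; bd.
by rewrite hcmp1E // => ->; rewrite top_idv -hdom_top ea hdom_hid.
Qed.

Lemma hinverse_bot a b X : hinverse a b -> bot a = hid X -> bot b = hid X.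
Proof.
move=> [e1 e2 e3 e4] ea.
have := congr1 (@bot D) e3; rewrite bot_hsq // ea.
have E : hdom (bot b) = X by rewrite hdom_bot -e1 -hcod_bot ea; bd.
by rewrite hcmp1E // => ->; rewrite bot_idv -hdom_bot ea hdom_hid.
Qed.

Lemma vinvertible_wr a (f : Hor D) : rgt a = vid (hdom f) ->
  vinvertible a -> vinvertible (a <|> idh f).
Proof.
move=> ea [b H]; have eb := vinverse_rgt H ea.
case: H => e1 e2 e3 e4.
exists (b <|> idh f); split; [bd|bd| |]; rewrite -wr //.
- by rewrite e3 -idh_hcmp ?top_hsq ?top_idh //; bd.
- by rewrite e4 -idh_hcmp ?top_hsq ?top_idh //; bd.
Qed.

Lemma vinvertible_wl a (f : Hor D) : lft a = vid (hcod f) ->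
  vinvertible a -> vinvertible (idh f <|> a).
Proof.
move=> ea [b H]; have eb := vinverse_lft H ea.
case: H => e1 e2 e3 e4.
exists (idh f <|> b); split; [bd|bd| |]; rewrite -wl //.
- by rewrite e3 -idh_hcmp ?top_hsq ?top_idh //; bd.
- by rewrite e4 -idh_hcmp ?top_hsq ?top_idh //; bd.
Qed.

Lemma hinvertible_wd a (u : Ver D) : bot a = hid (vdom u) ->
  hinvertible a -> hinvertible (a </> idv u).
Proof.
move=> ea [b H]; have eb := hinverse_bot H ea.
have ca : vcod (lft a) = vdom u by rewrite -hdom_bot ea; bd.
have cb : vcod (lft b) = vdom u by rewrite -hdom_bot eb; bd.
case: H => e1 e2 e3 e4.
exists (b </> idv u); split; [bd|bd| |]; rewrite -wd //.
- by rewrite e3 -idv_vcmp ?lft_vsq ?lft_idv //; bd.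
- by rewrite e4 -idv_vcmp ?lft_vsq ?lft_idv //; bd.
Qed.

Lemma hinvertible_wu a (u : Ver D) : top a = hid (vcod u) ->
  hinvertible a -> hinvertible (idv u </> a).
Proof.
move=> ea [b H]; have eb := hinverse_top H ea.
have ca : vdom (lft a) = vcod u by rewrite -hdom_top ea; bd.
have cb : vdom (lft b) = vcod u by rewrite -hdom_top eb; bd.
case: H => e1 e2 e3 e4.
exists (idv u </> b); split; [bd|bd| |]; rewrite -wu //.
- by rewrite e3 -idv_vcmp ?lft_vsq ?lft_idv //; bd.
- by rewrite e4 -idv_vcmp ?lft_vsq ?lft_idv //; bd.
Qed.

End Whisker.
Section HComp.
Variables (A B : dblCat).
Implicit Types (F G K : psFunctor A B) (al be : hTransData A B).

Definition hcompD al be : hTransData A B :=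
  HTransData (fun X => hc be X \oh hc al X)
    (fun u => hv al u <|> hv be u)
    (fun f => (hd al f <|> idh (hc be (hcod f)))
                </> (idh (hc al (hdom f)) <|> hd be f)).

Definition hidD F : hTransData A B :=
  HTransData (fun X => hid (fob F X)) (fun u => idv (fver F u))
    (fun f => idh (fhor F f)).

Lemma hidP F : isHTrans F F (hidD F).
Proof.
split=> /=; try by bd.
- by move=> u v e; rewrite fver_vcmp // idv_vcmp //; bd.
- by move=> X; rewrite fver_vid idh_hid.
- by move=> f; exists (idh (fhor F f)); split; rewrite ?vsq1E //; bd.
- move=> g f e; rewrite !idh_hid !hsq1E ?hsq1lE ?vsq1E ?vsq1lE //; try by bd.
  by rewrite -idh_hcmp ?vsq1lE //; bd.
- by move=> X; rewrite !idh_hid hsq1E ?hsq1lE ?vsq1E //; bd.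
- by move=> a; rewrite hsq1E ?hsq1lE ?vsq1E ?vsq1lE //; bd.
Qed.

Lemma hcompP F G K al be : isHTrans F G al -> isHTrans G K be ->
  isHTrans F K (hcompD al be).
Proof.
move=> H1 H2; split=> /=; try by bd.
- move=> u v e; rewrite (hv_vcmp H1) // (hv_vcmp H2) // sq_interchange //; bd.
- by move=> X; rewrite (hv_vid H1) (hv_vid H2) idh_hcmp //; bd.
- move=> f; apply: vinvertible_vsq; first by bd.
  + by apply: vinvertible_wr; [bd|apply: hd_inv H1 f].
  + by apply: vinvertible_wl; [bd|apply: hd_inv H2 f].
- move=> g f e.
  have E1 := congr1 (fun s => s <|> idh (hc be (hcod g))) (hd_hcmp H1 e).
  have E2 := congr1 (fun s => idh (hc al (hdom f)) <|> s) (hd_hcmp H2 e).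
  have S1 := slide_h (a := hd al f) (b := hd be g).
  have S2 := slide_h' (a := hd al f) (b := hd be g).
  rewrite (top_hd H1) (bot_hd H1) (top_hd H2) (bot_hd H2) in S1 S2.
  rewrite !hcod_hcmp // !hdom_hcmp // -?e in S1 S2 *.
  move: E1 E2 S1 S2; rewrite /= !wr ?wl; try by bd.
  rewrite !idh_hcmp; try by bd.
  rewrite !hsqA; try by bd.
  move=> E1 E2 S1 S2; rewrite vsqA; [|bd..]; rewrite E1.
  rewrite -(vsqA (b := _ <|> fcmp G e <|> _)); [|bd..].
  rewrite E2 !vsqA; try by bd.
  rewrite -(vsqA (a := _ <|> hd al g <|> _)); [|bd..].
  rewrite -[in RHS](vsqA (a := _ <|> hd al g <|> _)); [|bd..].
  by rewrite S1 ?S2; bd.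
- move=> X.
  have E1 := congr1 (fun s => s <|> idh (hc be X)) (hd_hid H1 X).
  have E2 := congr1 (fun s => idh (hc al X) <|> s) (hd_hid H2 X).
  move: E1 E2; rewrite /= hdom_hid hcod_hid !wr ?wl; try by bd.
  rewrite !idh_hcmp; try by bd.
  rewrite !hsqA; try by bd.
  move=> E1 E2; rewrite vsqA; [|bd..]; rewrite E1.
  by rewrite E2.
- move=> a.
  rewrite vsqA; try by bd.
  rewrite hsqA; try by bd.
  rewrite sq_interchange; try by bd.
  rewrite (hd_nat H1) vsq1E; try by bd.
  have -> : (hd al (top a) </> (hv al (lft a) <|> fsq G a)) <|> hv be (rgt a) =
     (hd al (top a) <|> idh (hc be (hcod (top a)))) </>
     (hv al (lft a) <|> (fsq G a <|> hv be (rgt a))).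
    rewrite hsqA; try by bd.
    by rewrite sq_interchange ?vsq1lE; bd.
  rewrite -vsqA; try by bd.
  rewrite -[in RHS]vsqA; try by bd. 
  congr (_ </> _).
  rewrite sq_interchange; try by bd.
  rewrite (hd_nat H2) vsq1E; try by bd.
  rewrite -hsqA; try by bd.
  by rewrite sq_interchange ?vsq1lE; bd.
Qed.
End HComp.

Section VComp.
Variables (A B : dblCat).
Implicit Types (F G K : psFunctor A B) (al be : vTransData A B).

Definition vcompD al be : vTransData A B :=
  VTransData (fun X => vc al X \ov vc be X)
    (fun f => vh al f </> vh be f)
    (fun u => (idv (vc al (vdom u)) </> vd be u)
                <|> (vd al u </> idv (vc be (vcod u)))).

Definition vidD F : vTransData A B :=
  VTransData (fun X => vid (fob F X)) (fun f => idh (fhor F f))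
    (fun u => idv (fver F u)).

Lemma vidP F : isVTrans F F (vidD F).
Proof.
split=> /=; try by bd.
- by move=> g f e; rewrite -idh_hcmp ?vsq1lE ?vsq1E //; bd.
- by move=> X; rewrite -idh_hid ?vsq1lE ?vsq1E //; bd.
- by move=> u; exists (idv (fver F u)); split; rewrite ?hsq1E //; bd.
- move=> u v e; rewrite -!idv_vcmp; [|bd..].
  by rewrite hsq1E ?fver_vcmp //; bd.
- by move=> a; rewrite hsq1E ?hsq1lE ?vsq1E ?vsq1lE //; bd.
Qed.

Lemma vcompP F G K al be : isVTrans F G al -> isVTrans G K be ->
  isVTrans F K (vcompD al be).
Proof.
move=> H1 H2; split=> /=; try by bd.
- move=> g f e; rewrite vsqA; [|bd..].
  rewrite (vh_hcmp H1) -vsqA; [|bd..].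
  by rewrite (vh_hcmp H2) vsqA ?sq_interchange; bd.
- move=> X; rewrite vsqA; [|bd..].
  rewrite (vh_hid H1) -vsqA; [|bd..].
  by rewrite (vh_hid H2) vsqA ?idv_vcmp; bd.
- move=> u; apply: hinvertible_hsq; first by bd.
  + by apply: hinvertible_wu; [bd|apply: vd_inv H2 u].
  + by apply: hinvertible_wd; [bd|apply: vd_inv H1 u].
- move=> u v e.
  have S1 := slide_v (a := vd al u) (b := vd be v).
  have S2 := slide_v' (a := vd al u) (b := vd be v).
  rewrite (lft_vd H1) (rgt_vd H1) (lft_vd H2) (rgt_vd H2) in S1 S2.
  rewrite !vcod_vcmp // !vdom_vcmp // -?e in S1 S2 *.
  rewrite (vd_vcmp H1) // (vd_vcmp H2) //.
  move: S1 S2; rewrite !wd ?wu; try by bd.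
  rewrite !idv_vcmp; try by bd.
  rewrite !vsqA; try by bd.
  rewrite !hsqA; try by bd.
  move=> S1 S2.
  rewrite -(hsqA (c := _ </> idv (fver G v) </> _)); [|bd..].
  rewrite -[in RHS](hsqA (c := _ </> vd be v)); [|bd..].
  by rewrite S2 ?S1; bd.
- by move=> X; rewrite (vd_vid H1) (vd_vid H2) vdom_vid vcod_vid
    -!idv_vcmp ?hsq1E; bd.
- move=> a.
  rewrite -hsqA; try by bd.
  rewrite vsqA; try by bd.
  rewrite -sq_interchange; try by bd.
  rewrite (vd_nat H1) hsq1lE; try by bd.
  have -> : ((vh al (top a) </> fsq G a) <|> vd al (rgt a)) </> vh be (bot a) =
     (vh al (top a) </> (fsq G a </> vh be (bot a))) <|>
     (vd al (rgt a) </> idv (vc be (vcod (rgt a)))).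
    rewrite vsqA; try by bd.
    by rewrite -sq_interchange ?hsq1E; bd.
  rewrite !hsqA; try by bd.
  congr (_ <|> _).
  rewrite -sq_interchange; try by bd.
  rewrite (vd_nat H2) hsq1lE; try by bd.
  rewrite -vsqA; try by bd.
  by rewrite -sq_interchange ?hsq1E; bd.
Qed.

End VComp.

Section ModComp.
Variables (A B : dblCat).
Implicit Types (F G K : psFunctor A B).

Lemma mod_idh F G (al : hTransData A B) : isHTrans F G al ->
  isModif al al (vidD F) (vidD G) (fun X => idh (hc al X)).
Proof.
move=> H; split=> /=; try by bd.
- move=> f; rewrite -!idh_hcmp; [|bd..].
  by rewrite vsq1E ?vsq1lE; bd.
- by move=> u; rewrite vsq1E ?vsq1lE ?hsq1E ?hsq1lE; bd.
Qed.

Lemma mod_idv F G (al : vTransData A B) : isVTrans F G al ->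
  isModif (hidD F) (hidD G) al al (fun X => idv (vc al X)).
Proof.
move=> H; split=> /=; try by bd.
- by move=> f; rewrite hsq1E ?hsq1lE ?vsq1E ?vsq1lE; bd.
- move=> u; rewrite -!idv_vcmp; [|bd..].
  by rewrite hsq1E ?hsq1lE; bd.
Qed.

Lemma mod_hsq F1 F2 F3 G1 G2 G3 (al al' be be' : hTransData A B)
    (a0 b0 c0 : vTransData A B) (th xi : Ob A -> Sq B) :
  isHTrans F1 F2 al -> isHTrans F2 F3 al' ->
  isHTrans G1 G2 be -> isHTrans G2 G3 be' ->
  isVTrans F1 G1 a0 -> isVTrans F2 G2 b0 -> isVTrans F3 G3 c0 ->
  isModif al be a0 b0 th -> isModif al' be' b0 c0 xi ->
  isModif (hcompD al al') (hcompD be be') a0 c0 (fun X => th X <|> xi X).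
Proof.
move=> H1 H2 H3 H4 V1 V2 V3 M1 M2; split=> /=; try by bd.
- move=> f; rewrite hsqA; [|bd..].
  rewrite vsqA; try by bd.
  rewrite sq_interchange; try by bd.
  rewrite (mod_hor M1) vsq1E; try by bd.
  have -> : (hd al f </> (th (hdom f) <|> vh b0 f)) <|> xi (hcod f) =
     (hd al f <|> idh (hc al' (hcod f))) </>
     (th (hdom f) <|> (vh b0 f <|> xi (hcod f))).
    rewrite hsqA; try by bd.
    by rewrite sq_interchange ?vsq1lE; bd.
  rewrite -vsqA; try by bd.
  rewrite -[in RHS]vsqA; try by bd.
  congr (_ </> _).
  rewrite sq_interchange; try by bd.
  rewrite (mod_hor M2) vsq1E; try by bd.
  rewrite -hsqA; try by bd.
  by rewrite sq_interchange ?vsq1lE; bd.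
- move=> u.
  rewrite sq_interchange; try by bd.
  rewrite hsqA; try by bd.
  rewrite (mod_ver M1) -hsqA; try by bd.
  rewrite (mod_ver M2) hsqA; try by bd.
  by rewrite sq_interchange; bd.
Qed.

Lemma mod_vsq F1 F2 F3 G1 G2 G3 (al be ga : hTransData A B)
    (a0 b0 a1 b1 : vTransData A B) (th xi : Ob A -> Sq B) :
  isHTrans F1 G1 al -> isHTrans F2 G2 be -> isHTrans F3 G3 ga ->
  isVTrans F1 F2 a0 -> isVTrans G1 G2 b0 ->
  isVTrans F2 F3 a1 -> isVTrans G2 G3 b1 ->
  isModif al be a0 b0 th -> isModif be ga a1 b1 xi ->
  isModif al ga (vcompD a0 a1) (vcompD b0 b1) (fun X => th X </> xi X).
Proof.
move=> H1 H2 H3 V1 V2 V3 V4 M1 M2; split=> /=; try by bd.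
- move=> f.
  rewrite -sq_interchange; try by bd.
  rewrite -vsqA; try by bd.
  rewrite (mod_hor M2) vsqA; try by bd.
  rewrite (mod_hor M1) -vsqA; try by bd.
  by rewrite sq_interchange; bd.
- move=> u; rewrite vsqA; [|bd..].
  rewrite -hsqA; try by bd.
  rewrite -sq_interchange; try by bd.
  rewrite (mod_ver M1) hsq1lE; try by bd.
  have -> : ((th (vdom u) </> hv be u) <|> vd b0 u) </> xi (vcod u) =
     (th (vdom u) </> (hv be u </> xi (vcod u))) <|>
     (vd b0 u </> idv (vc b1 (vcod u))).
    rewrite vsqA; try by bd.
    by rewrite -sq_interchange ?hsq1E; bd.
  rewrite !hsqA; try by bd.
  congr (_ <|> _).
  rewrite -sq_interchange; try by bd.
  rewrite (mod_ver M2) hsq1lE; try by bd.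
  rewrite -vsqA; try by bd.
  by rewrite -sq_interchange ?hsq1E; bd.
Qed.

End ModComp.

Section Pseudo.
Variables (A B : dblCat).
Implicit Types (F G : psFunctor A B) (al be ga : hTrans A B)
  (sg ta ro : vTrans A B) (th xi ze : modif A B).

Lemma hTransData_eq (x y : hTransData A B) :
  hc x =1 hc y -> hv x =1 hv y -> hd x =1 hd y -> x = y.
Proof.
by case: x y => [? ? ?] [? ? ?] /= /funext-> /funext-> /funext->.
Qed.

Lemma vTransData_eq (x y : vTransData A B) :
  vc x =1 vc y -> vh x =1 vh y -> vd x =1 vd y -> x = y.
Proof.
by case: x y => [? ? ?] [? ? ?] /= /funext-> /funext-> /funext->.
Qed.

Lemma hTrans_eq al be :
  hsrc al = hsrc be -> htgt al = htgt be -> hdat al = hdat be -> al = be.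
Proof.
case: al be => [? ? ? p] [? ? ? q] /= e1 e2 e3; subst.
by congr HTrans; apply: Prop_irrelevance.
Qed.

Lemma vTrans_eq sg ta :
  vsrc sg = vsrc ta -> vtgt sg = vtgt ta -> vdat sg = vdat ta -> sg = ta.
Proof.
case: sg ta => [? ? ? p] [? ? ? q] /= e1 e2 e3; subst.
by congr VTrans; apply: Prop_irrelevance.
Qed.

Lemma modif_eq th xi :
  mtop th = mtop xi -> mbot th = mbot xi -> mlft th = mlft xi ->
  mrgt th = mrgt xi -> mdat th =1 mdat xi -> th = xi.
Proof.
case: th xi => [? ? ? ? ? p1 p2 p3 p4 p5] [? ? ? ? ? q1 q2 q3 q4 q5] /=.
move=> e1 e2 e3 e4 /funext e5; subst.
by congr Modif; apply: Prop_irrelevance.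
Qed.

Definition hidT F : hTrans A B := HTrans (hidP F).
Definition vidT F : vTrans A B := VTrans (vidP F).

Lemma hcmpT_subproof al be : htgt al = hsrc be ->
  isHTrans (hsrc al) (htgt be) (hcompD al be).
Proof.
by move=> e; apply: hcompP (hTransP al) _; rewrite e; apply: hTransP.
Qed.

(* The value on non-composable pairs is irrelevant. *)
Definition hcmpT be al : hTrans A B :=
  if pselect (htgt al = hsrc be) is left e then HTrans (hcmpT_subproof e)
  else be.

Lemma vcmpT_subproof sg ta : vtgt sg = vsrc ta ->
  isVTrans (vsrc sg) (vtgt ta) (vcompD sg ta).
Proof.
by move=> e; apply: vcompP (vTransP sg) _; rewrite e; apply: vTransP.
Qed.

Definition vcmpT sg ta : vTrans A B :=
  if pselect (vtgt sg = vsrc ta) is left e then VTrans (vcmpT_subproof e)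
  else sg.

Lemma hcmpTE al be : htgt al = hsrc be ->
  [/\ hsrc (hcmpT be al) = hsrc al, htgt (hcmpT be al) = htgt be
    & hdat (hcmpT be al) = hcompD al be].
Proof. by rewrite /hcmpT; case: pselect. Qed.

Lemma vcmpTE sg ta : vtgt sg = vsrc ta ->
  [/\ vsrc (vcmpT sg ta) = vsrc sg, vtgt (vcmpT sg ta) = vtgt ta
    & vdat (vcmpT sg ta) = vcompD sg ta].
Proof. by rewrite /vcmpT; case: pselect. Qed.

Lemma hsrc_hcmpT al be : htgt al = hsrc be -> hsrc (hcmpT be al) = hsrc al.
Proof. by case/hcmpTE. Qed.
Lemma htgt_hcmpT al be : htgt al = hsrc be -> htgt (hcmpT be al) = htgt be.
Proof. by case/hcmpTE. Qed.
Lemma hdat_hcmpT al be : htgt al = hsrc be ->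
  hdat (hcmpT be al) = hcompD al be.
Proof. by case/hcmpTE. Qed.
Lemma vsrc_vcmpT sg ta : vtgt sg = vsrc ta -> vsrc (vcmpT sg ta) = vsrc sg.
Proof. by case/vcmpTE. Qed.
Lemma vtgt_vcmpT sg ta : vtgt sg = vsrc ta -> vtgt (vcmpT sg ta) = vtgt ta.
Proof. by case/vcmpTE. Qed.
Lemma vdat_vcmpT sg ta : vtgt sg = vsrc ta ->
  vdat (vcmpT sg ta) = vcompD sg ta.
Proof. by case/vcmpTE. Qed.

Definition idhT al : modif A B :=
  @Modif A B al al (vidT (hsrc al)) (vidT (htgt al)) _ erefl erefl erefl erefl
    (mod_idh (hTransP al)).

Definition idvT sg : modif A B :=
  @Modif A B (hidT (vsrc sg)) (hidT (vtgt sg)) sg sg _ erefl erefl erefl erefl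
    (mod_idv (vTransP sg)).

Lemma mtop_comp th xi : mrgt th = mlft xi -> htgt (mtop th) = hsrc (mtop xi).
Proof. by move=> e; rewrite m_tr e -m_tl. Qed.
Lemma mbot_comp th xi : mrgt th = mlft xi -> htgt (mbot th) = hsrc (mbot xi).
Proof. by move=> e; rewrite m_br e -m_bl. Qed.
Lemma mlft_comp th xi : mbot th = mtop xi -> vtgt (mlft th) = vsrc (mlft xi).
Proof. by move=> e; rewrite -m_bl e m_tl. Qed.
Lemma mrgt_comp th xi : mbot th = mtop xi -> vtgt (mrgt th) = vsrc (mrgt xi).
Proof. by move=> e; rewrite -m_br e m_tr. Qed.

Definition hsqT th xi : modif A B.
Proof.
case: (pselect (mrgt th = mlft xi)) => [e|_]; last exact: th.
apply: (@Modif A B (hcmpT (mtop xi) (mtop th)) (hcmpT (mbot xi) (mbot th))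
  (mlft th) (mrgt xi) (fun X => th X <|> xi X)).
- by rewrite hsrc_hcmpT; [exact: m_tl|exact: mtop_comp].
- by rewrite htgt_hcmpT; [exact: m_tr|exact: mtop_comp].
- by rewrite hsrc_hcmpT; [exact: m_bl|exact: mbot_comp].
- by rewrite htgt_hcmpT; [exact: m_br|exact: mbot_comp].
- rewrite !hdat_hcmpT; try solve [exact: mbot_comp | exact: mtop_comp].
  have M2 := modifP xi; rewrite -e in M2.
  have V := vTransP (mlft th); rewrite -m_tl -m_bl in V.
  have W := vTransP (mrgt th); rewrite -m_tr -m_br in W.
  have Z := vTransP (mrgt xi); rewrite -m_tr -m_br in Z.
  have T2 := hTransP (mtop xi); rewrite -(mtop_comp e) in T2.
  have B2 := hTransP (mbot xi); rewrite -(mbot_comp e) in B2.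
  exact: (mod_hsq (hTransP (mtop th)) T2 (hTransP (mbot th)) B2 V W Z
    (modifP th) M2).
Defined.

Definition vsqT th xi : modif A B.
Proof.
case: (pselect (mbot th = mtop xi)) => [e|_]; last exact: th.
apply: (@Modif A B (mtop th) (mbot xi)
  (vcmpT (mlft th) (mlft xi)) (vcmpT (mrgt th) (mrgt xi))
  (fun X => th X </> xi X)).
- by rewrite vsrc_vcmpT; [exact: m_tl|exact: mlft_comp].
- by rewrite vsrc_vcmpT; [exact: m_tr|exact: mrgt_comp].
- by rewrite vtgt_vcmpT; [exact: m_bl|exact: mlft_comp].
- by rewrite vtgt_vcmpT; [exact: m_br|exact: mrgt_comp].
- rewrite !vdat_vcmpT; try solve [exact: mrgt_comp | exact: mlft_comp].
  have M2 := modifP xi; rewrite -e in M2.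
  have T := hTransP (mtop th); rewrite m_tl m_tr in T.
  have U := hTransP (mbot th); rewrite m_bl m_br in U.
  have Z := hTransP (mbot xi); rewrite m_bl m_br in Z.
  have L2 := vTransP (mlft xi); rewrite -(mlft_comp e) in L2.
  have R2 := vTransP (mrgt xi); rewrite -(mrgt_comp e) in R2.
  exact: (mod_vsq T U Z (vTransP (mlft th)) (vTransP (mrgt th)) L2 R2
    (modifP th) M2).
Defined.

Lemma hsqTE th xi : mrgt th = mlft xi ->
  [/\ mtop (hsqT th xi) = hcmpT (mtop xi) (mtop th),
      mbot (hsqT th xi) = hcmpT (mbot xi) (mbot th),
      mlft (hsqT th xi) = mlft th, mrgt (hsqT th xi) = mrgt xi
    & mdat (hsqT th xi) = fun X => th X <|> xi X].
Proof. by rewrite /hsqT; case: pselect. Qed.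

Lemma vsqTE th xi : mbot th = mtop xi ->
  [/\ mtop (vsqT th xi) = mtop th, mbot (vsqT th xi) = mbot xi,
      mlft (vsqT th xi) = vcmpT (mlft th) (mlft xi),
      mrgt (vsqT th xi) = vcmpT (mrgt th) (mrgt xi)
    & mdat (vsqT th xi) = fun X => th X </> xi X].
Proof. by rewrite /vsqT; case: pselect. Qed.

Lemma mtop_hsqT th xi : mrgt th = mlft xi ->
  mtop (hsqT th xi) = hcmpT (mtop xi) (mtop th).
Proof. by case/hsqTE. Qed.
Lemma mbot_hsqT th xi : mrgt th = mlft xi ->
  mbot (hsqT th xi) = hcmpT (mbot xi) (mbot th).
Proof. by case/hsqTE. Qed.
Lemma mlft_hsqT th xi : mrgt th = mlft xi -> mlft (hsqT th xi) = mlft th.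
Proof. by case/hsqTE. Qed.
Lemma mrgt_hsqT th xi : mrgt th = mlft xi -> mrgt (hsqT th xi) = mrgt xi.
Proof. by case/hsqTE. Qed.
Lemma mdat_hsqT th xi X : mrgt th = mlft xi ->
  mdat (hsqT th xi) X = th X <|> xi X.
Proof. by case/hsqTE => _ _ _ _ ->. Qed.
Lemma mtop_vsqT th xi : mbot th = mtop xi -> mtop (vsqT th xi) = mtop th.
Proof. by case/vsqTE. Qed.
Lemma mbot_vsqT th xi : mbot th = mtop xi -> mbot (vsqT th xi) = mbot xi.
Proof. by case/vsqTE. Qed.
Lemma mlft_vsqT th xi : mbot th = mtop xi ->
  mlft (vsqT th xi) = vcmpT (mlft th) (mlft xi).
Proof. by case/vsqTE. Qed.
Lemma mrgt_vsqT th xi : mbot th = mtop xi ->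
  mrgt (vsqT th xi) = vcmpT (mrgt th) (mrgt xi).
Proof. by case/vsqTE. Qed.
Lemma mdat_vsqT th xi X : mbot th = mtop xi ->
  mdat (vsqT th xi) X = th X </> xi X.
Proof. by case/vsqTE => _ _ _ _ ->. Qed.

Lemma hcmpT1 al : hcmpT al (hidT (hsrc al)) = al.
Proof.
have H := hTransP al.
apply: hTrans_eq; rewrite ?hsrc_hcmpT ?htgt_hcmpT ?hdat_hcmpT //.
apply: hTransData_eq => [X|u|f] /=.
- by rewrite hcmp1E; bd.
- by rewrite hsq1lE; bd.
- by rewrite -idh_hcmp ?vsq1lE ?idh_hid ?hsq1lE; bd.
Qed.

Lemma hcmpT1l al : hcmpT (hidT (htgt al)) al = al.
Proof.
have H := hTransP al.
apply: hTrans_eq; rewrite ?hsrc_hcmpT ?htgt_hcmpT ?hdat_hcmpT //.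
apply: hTransData_eq => [X|u|f] /=.
- by rewrite hcmp1lE; bd.
- by rewrite hsq1E; bd.
- by rewrite -idh_hcmp ?vsq1E ?idh_hid ?hsq1E; bd.
Qed.

Lemma hcmpTA al be ga : htgt al = hsrc be -> htgt be = hsrc ga ->
  hcmpT ga (hcmpT be al) = hcmpT (hcmpT ga be) al.
Proof.
move=> e1 e2.
have e3 : htgt (hcmpT be al) = hsrc ga by rewrite htgt_hcmpT.
have e4 : htgt al = hsrc (hcmpT ga be) by rewrite hsrc_hcmpT.
have H1 := hTransP al; have H2 := hTransP be; have H3 := hTransP ga.
rewrite -e1 in H2; rewrite -e2 in H3.
apply: hTrans_eq; rewrite ?hsrc_hcmpT ?htgt_hcmpT ?hdat_hcmpT //.
apply: hTransData_eq => [X|u|f] /=.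
- by rewrite hcmpA; bd.
- by rewrite hsqA; bd.
- rewrite !wr ?wl; try by bd.
  rewrite !idh_hcmp; try by bd.
  rewrite !vsqA; try by bd.
  by rewrite !hsqA; bd.
Qed.

Lemma vcmpT1l sg : vcmpT (vidT (vsrc sg)) sg = sg.
Proof.
have H := vTransP sg.
apply: vTrans_eq; rewrite ?vsrc_vcmpT ?vtgt_vcmpT ?vdat_vcmpT //.
apply: vTransData_eq => [X|f|u] /=.
- by rewrite vcmp1lE; bd.
- by rewrite vsq1lE; bd.
- by rewrite -idv_vcmp ?hsq1E -?idh_hid ?vsq1lE; bd.
Qed.

Lemma vcmpT1 sg : vcmpT sg (vidT (vtgt sg)) = sg.
Proof.
have H := vTransP sg.
apply: vTrans_eq; rewrite ?vsrc_vcmpT ?vtgt_vcmpT ?vdat_vcmpT //.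
apply: vTransData_eq => [X|f|u] /=.
- by rewrite vcmp1E; bd.
- by rewrite vsq1E; bd.
- by rewrite -idv_vcmp ?hsq1lE -?idh_hid ?vsq1E; bd.
Qed.

Lemma vcmpTA sg ta ro : vtgt sg = vsrc ta -> vtgt ta = vsrc ro ->
  vcmpT sg (vcmpT ta ro) = vcmpT (vcmpT sg ta) ro.
Proof.
move=> e1 e2.
have e3 : vtgt (vcmpT sg ta) = vsrc ro by rewrite vtgt_vcmpT.
have e4 : vtgt sg = vsrc (vcmpT ta ro) by rewrite vsrc_vcmpT.
have H1 := vTransP sg; have H2 := vTransP ta; have H3 := vTransP ro.
rewrite -e1 in H2; rewrite -e2 in H3.
apply: vTrans_eq; rewrite ?vsrc_vcmpT ?vtgt_vcmpT ?vdat_vcmpT //.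
apply: vTransData_eq => [X|f|u] /=.
- by rewrite vcmpA; bd.
- by rewrite vsqA; bd.
- rewrite !wd ?wu; try by bd.
  rewrite !idv_vcmp; try by bd.
  rewrite !hsqA; try by bd.
  by rewrite !vsqA; bd.
Qed.

Lemma hsqT1l th : hsqT (idvT (mlft th)) th = th.
Proof.
apply: modif_eq => [||||X];
  rewrite ?mtop_hsqT ?mbot_hsqT ?mlft_hsqT ?mrgt_hsqT ?mdat_hsqT //=.
- by rewrite -m_tl hcmpT1.
- by rewrite -m_bl hcmpT1.
- by have M := modifP th; rewrite hsq1lE; bd.
Qed.

Lemma hsqT1 th : hsqT th (idvT (mrgt th)) = th.
Proof.
apply: modif_eq => [||||X];
  rewrite ?mtop_hsqT ?mbot_hsqT ?mlft_hsqT ?mrgt_hsqT ?mdat_hsqT //=.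
- by rewrite -m_tr hcmpT1l.
- by rewrite -m_br hcmpT1l.
- by have M := modifP th; rewrite hsq1E; bd.
Qed.

Lemma vsqT1l th : vsqT (idhT (mtop th)) th = th.
Proof.
apply: modif_eq => [||||X];
  rewrite ?mtop_vsqT ?mbot_vsqT ?mlft_vsqT ?mrgt_vsqT ?mdat_vsqT //=.
- by rewrite m_tl vcmpT1l.
- by rewrite m_tr vcmpT1l.
- by have M := modifP th; rewrite vsq1lE; bd.
Qed.

Lemma vsqT1 th : vsqT th (idhT (mbot th)) = th.
Proof.
apply: modif_eq => [||||X];
  rewrite ?mtop_vsqT ?mbot_vsqT ?mlft_vsqT ?mrgt_vsqT ?mdat_vsqT //=.
- by rewrite m_bl vcmpT1.
- by rewrite m_br vcmpT1.
- by have M := modifP th; rewrite vsq1E; bd.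
Qed.

Lemma hsqTA th xi ze : mrgt th = mlft xi -> mrgt xi = mlft ze ->
  hsqT th (hsqT xi ze) = hsqT (hsqT th xi) ze.
Proof.
move=> e1 e2.
have e3 : mrgt th = mlft (hsqT xi ze) by rewrite mlft_hsqT.
have e4 : mrgt (hsqT th xi) = mlft ze by rewrite mrgt_hsqT.
apply: modif_eq => [||||X]; do ?[rewrite mtop_hsqT // | rewrite mbot_hsqT //
  | rewrite mlft_hsqT // | rewrite mrgt_hsqT // | rewrite mdat_hsqT //].
- by rewrite hcmpTA //; apply: mtop_comp.
- by rewrite hcmpTA //; apply: mbot_comp.
- have M1 := modifP th; have M2 := modifP xi; have M3 := modifP ze.
  rewrite -e1 in M2; rewrite -e2 in M3.
  by rewrite hsqA; bd.
Qed.

Lemma vsqTA th xi ze : mbot th = mtop xi -> mbot xi = mtop ze ->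
  vsqT th (vsqT xi ze) = vsqT (vsqT th xi) ze.
Proof.
move=> e1 e2.
have e3 : mbot th = mtop (vsqT xi ze) by rewrite mtop_vsqT.
have e4 : mbot (vsqT th xi) = mtop ze by rewrite mbot_vsqT.
apply: modif_eq => [||||X]; do ?[rewrite mtop_vsqT // | rewrite mbot_vsqT //
  | rewrite mlft_vsqT // | rewrite mrgt_vsqT // | rewrite mdat_vsqT //].
- by rewrite vcmpTA //; apply: mlft_comp.
- by rewrite vcmpTA //; apply: mrgt_comp.
- have M1 := modifP th; have M2 := modifP xi; have M3 := modifP ze.
  rewrite -e1 in M2; rewrite -e2 in M3.
  by rewrite vsqA; bd.
Qed.

Lemma interchangeT th xi ze ps : mrgt th = mlft xi -> mrgt ze = mlft ps ->
  mbot th = mtop ze -> mbot xi = mtop ps ->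
  vsqT (hsqT th xi) (hsqT ze ps) = hsqT (vsqT th ze) (vsqT xi ps).
Proof.
move=> e1 e2 e3 e4.
have e5 : mbot (hsqT th xi) = mtop (hsqT ze ps).
  by rewrite mbot_hsqT // mtop_hsqT // e3 e4.
have e6 : mrgt (vsqT th ze) = mlft (vsqT xi ps).
  by rewrite mrgt_vsqT // mlft_vsqT // e1 e2.
apply: modif_eq => [||||X]; do ?[rewrite mtop_vsqT // | rewrite mbot_vsqT //
  | rewrite mlft_vsqT // | rewrite mrgt_vsqT // | rewrite mdat_vsqT //
  | rewrite mtop_hsqT // | rewrite mbot_hsqT //
  | rewrite mlft_hsqT // | rewrite mrgt_hsqT // | rewrite mdat_hsqT //].
have M1 := modifP th; have M2 := modifP xi; have M3 := modifP ze.
have M4 := modifP ps.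
rewrite -e1 in M2; rewrite -e3 in M3; rewrite -e4 -e2 in M4.
by rewrite sq_interchange; bd.
Qed.

Lemma idh_hidT F : idhT (hidT F) = idvT (vidT F).
Proof. by apply: modif_eq => //= X; rewrite idh_hid. Qed.

Lemma idh_hcmpT al be : htgt al = hsrc be ->
  idhT (hcmpT be al) = hsqT (idhT al) (idhT be).
Proof.
move=> e; have e' : mrgt (idhT al) = mlft (idhT be) by rewrite /= e.
apply: modif_eq => [||||X];
  rewrite ?mtop_hsqT ?mbot_hsqT ?mlft_hsqT ?mrgt_hsqT ?mdat_hsqT //=.
- by rewrite hsrc_hcmpT.
- by rewrite htgt_hcmpT.
- have H1 := hTransP al; have H2 := hTransP be; rewrite -e in H2.
  by rewrite hdat_hcmpT //= idh_hcmp; bd.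
Qed.

Lemma idv_vcmpT sg ta : vtgt sg = vsrc ta ->
  idvT (vcmpT sg ta) = vsqT (idvT sg) (idvT ta).
Proof.
move=> e; have e' : mbot (idvT sg) = mtop (idvT ta) by rewrite /= e.
apply: modif_eq => [||||X];
  rewrite ?mtop_vsqT ?mbot_vsqT ?mlft_vsqT ?mrgt_vsqT ?mdat_vsqT //=.
- by rewrite vsrc_vcmpT.
- by rewrite vtgt_vcmpT.
- have H1 := vTransP sg; have H2 := vTransP ta; rewrite -e in H2.
  by rewrite vdat_vcmpT //= idv_vcmp; bd.
Qed.

Definition Pseudo : dblCat :=
  @DblCat (psFunctor A B) (hTrans A B) (vTrans A B) (modif A B)
    (@hsrc A B) (@htgt A B) (@vsrc A B) (@vtgt A B)
    (@mtop A B) (@mbot A B) (@mlft A B) (@mrgt A B)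
    hidT vidT idhT idvT hcmpT vcmpT hsqT vsqT
    (@m_tl A B) (@m_tr A B) (@m_bl A B) (@m_br A B)
    (fun=> erefl) (fun=> erefl) hsrc_hcmpT htgt_hcmpT hcmpT1 hcmpT1l hcmpTA
    (fun=> erefl) (fun=> erefl) vsrc_vcmpT vtgt_vcmpT vcmpT1l vcmpT1 vcmpTA
    (fun=> erefl) (fun=> erefl) (fun=> erefl) (fun=> erefl)
    (fun=> erefl) (fun=> erefl) (fun=> erefl) (fun=> erefl)
    mtop_hsqT mbot_hsqT mlft_hsqT mrgt_hsqT
    mtop_vsqT mbot_vsqT mlft_vsqT mrgt_vsqT
    hsqT1l hsqT1 hsqTA vsqT1l vsqT1 vsqTA interchangeT
    idh_hidT idh_hcmpT idv_vcmpT.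

End Pseudo.

(* qr A = H(A,-), ql B = H(-,B); for 1h-cells K, k and 1v-cells U, u,
   qhh K k = H(K,k), qhv K u = H(K,u), qvh U k = H(U,k), qvv U u = H(U,u). *)
Record quasiFunctor (A B C : dblCat) := QuasiFunctor {
  qr : Ob A -> psFunctor B C;
  ql : Ob B -> psFunctor A C;
  qob : forall X Y, fob (qr X) Y = fob (ql Y) X;
  qhh : Hor A -> Hor B -> Sq C;
  qhv : Hor A -> Ver B -> Sq C;
  qvh : Ver A -> Hor B -> Sq C;
  qvv : Ver A -> Ver B -> Sq C;
  top_qhh : forall K k,
    top (qhh K k) = fhor (ql (hcod k)) K \oh fhor (qr (hdom K)) k;
  bot_qhh : forall K k,
    bot (qhh K k) = fhor (qr (hcod K)) k \oh fhor (ql (hdom k)) K;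
  qhh_glob : forall K k, hglobular (qhh K k);
  qhh_inv : forall K k, vinvertible (qhh K k);
  top_qhv : forall K u, top (qhv K u) = fhor (ql (vdom u)) K;
  bot_qhv : forall K u, bot (qhv K u) = fhor (ql (vcod u)) K;
  lft_qhv : forall K u, lft (qhv K u) = fver (qr (hdom K)) u;
  rgt_qhv : forall K u, rgt (qhv K u) = fver (qr (hcod K)) u;
  top_qvh : forall U k, top (qvh U k) = fhor (qr (vdom U)) k;
  bot_qvh : forall U k, bot (qvh U k) = fhor (qr (vcod U)) k;
  lft_qvh : forall U k, lft (qvh U k) = fver (ql (hdom k)) U;
  rgt_qvh : forall U k, rgt (qvh U k) = fver (ql (hcod k)) U;
  lft_qvv : forall U u,
    lft (qvv U u) = fver (ql (vdom u)) U \ov fver (qr (vcod U)) u;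
  rgt_qvv : forall U u,
    rgt (qvv U u) = fver (qr (vdom U)) u \ov fver (ql (vcod u)) U;
  qvv_glob : forall U u, vglobular (qvv U u);
  qvv_inv : forall U u, hinvertible (qvv U u);
  qhh_hidr : forall K Y,
    (funt (qr (hdom K)) Y <|> idh (fhor (ql Y) K)) </> qhh K (hid Y) =
    idh (fhor (ql Y) K) <|> funt (qr (hcod K)) Y;
  qhh_hidl : forall X k,
    (idh (fhor (qr X) k) <|> funt (ql (hcod k)) X) </> qhh (hid X) k =
    funt (ql (hdom k)) X <|> idh (fhor (qr X) k);
  qhv_hid : forall X u,
    funt (ql (vdom u)) X </> qhv (hid X) u =
    idv (fver (qr X) u) </> funt (ql (vcod u)) X;
  qvh_hid : forall U Y,
    funt (qr (vdom U)) Y </> qvh U (hid Y) =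
    idv (fver (ql Y) U) </> funt (qr (vcod U)) Y;
  qhv_vid : forall K Y, qhv K (vid Y) = idh (fhor (ql Y) K);
  qvh_vid : forall X k, qvh (vid X) k = idh (fhor (qr X) k);
  qvv_vidr : forall U Y, qvv U (vid Y) = idv (fver (ql Y) U);
  qvv_vidl : forall X u, qvv (vid X) u = idv (fver (qr X) u);
  qhh_hcmpr : forall K k k' (e : hcod k = hdom k'),
    (idh (fhor (qr (hdom K)) k) <|> qhh K k')
      </> (qhh K k <|> idh (fhor (qr (hcod K)) k'))
      </> (idh (fhor (ql (hdom k)) K) <|> fcmp (qr (hcod K)) e) =
    (fcmp (qr (hdom K)) e <|> idh (fhor (ql (hcod k')) K))
      </> qhh K (k' \oh k);
  qhh_hcmpl : forall K K' k (e : hcod K = hdom K'),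
    (idh (fhor (qr (hdom K)) k) <|> fcmp (ql (hcod k)) e)
      </> qhh (K' \oh K) k =
    (qhh K k <|> idh (fhor (ql (hcod k)) K'))
      </> (idh (fhor (ql (hdom k)) K) <|> qhh K' k)
      </> (fcmp (ql (hdom k)) e <|> idh (fhor (qr (hcod K')) k));
  qhv_hcmp : forall K K' u (e : hcod K = hdom K'),
    fcmp (ql (vdom u)) e </> qhv (K' \oh K) u =
    (qhv K u <|> qhv K' u) </> fcmp (ql (vcod u)) e;
  qvh_hcmp : forall U k k' (e : hcod k = hdom k'),
    fcmp (qr (vdom U)) e </> qvh U (k' \oh k) =
    (qvh U k <|> qvh U k') </> fcmp (qr (vcod U)) e;
  qhv_vcmp : forall K u u', vcod u = vdom u' ->
    qhv K (u \ov u') = qhv K u </> qhv K u';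
  qvh_vcmp : forall U U' k, vcod U = vdom U' ->
    qvh (U \ov U') k = qvh U k </> qvh U' k;
  qvv_vcmpl : forall U U' u, vcod U = vdom U' ->
    qvv (U \ov U') u =
    (idv (fver (ql (vdom u)) U) </> qvv U' u)
      <|> (qvv U u </> idv (fver (ql (vcod u)) U'));
  qvv_vcmpr : forall U u u', vcod u = vdom u' ->
    qvv U (u \ov u') =
    (qvv U u </> idv (fver (qr (vcod U)) u'))
      <|> (idv (fver (qr (vdom U)) u) </> qvv U u');
  qhh_natr : forall K w,
    qhh K (top w) </> (qhv K (lft w) <|> fsq (qr (hcod K)) w) =
    (fsq (qr (hdom K)) w <|> qhv K (rgt w)) </> qhh K (bot w);
  qhh_natl : forall z k,
    qhh (top z) k </> (fsq (ql (hdom k)) z <|> qvh (rgt z) k) =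
    (qvh (lft z) k <|> fsq (ql (hcod k)) z) </> qhh (bot z) k;
  qvv_natr : forall U w,
    qvv U (lft w) <|> (fsq (qr (vdom U)) w </> qvh U (bot w)) =
    (qvh U (top w) </> fsq (qr (vcod U)) w) <|> qvv U (rgt w);
  qvv_natl : forall z u,
    qvv (lft z) u <|> (qhv (top z) u </> fsq (ql (vcod u)) z) =
    (fsq (ql (vdom u)) z </> qhv (bot z) u) <|> qvv (rgt z) u
}.

(* lact X = X \ltimes -  and  ract Y = - \rtimes Y. *)
Record binoidal (B : dblCat) := Binoidal {
  lact : Ob B -> psFunctor B B;
  ract : Ob B -> psFunctor B B;
  act_ob : forall X Y, fob (lact X) Y = fob (ract Y) X
}.

Section Central.
Variables (B : dblCat) (bn : binoidal B).

Definition lcentral_hor (K : Hor B) (al : hTransData B B) : Prop :=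
  isHTrans (lact bn (hdom K)) (lact bn (hcod K)) al /\
  (forall Y, hc al Y = fhor (ract bn Y) K).

Definition rcentral_hor (k : Hor B) (al : hTransData B B) : Prop :=
  isHTrans (ract bn (hdom k)) (ract bn (hcod k)) al /\
  (forall X, hc al X = fhor (lact bn X) k).

Definition lcentral_ver (U : Ver B) (al : vTransData B B) : Prop :=
  isVTrans (lact bn (vdom U)) (lact bn (vcod U)) al /\
  (forall Y, vc al Y = fver (ract bn Y) U).

Definition rcentral_ver (u : Ver B) (al : vTransData B B) : Prop :=
  isVTrans (ract bn (vdom u)) (ract bn (vcod u)) al /\
  (forall X, vc al X = fver (lact bn X) u).

(* Centrality of a square, given the transformations lh, lv (resp. rh, rv)
   that make its sides central. *)
Definition lcentral_sq (lh : Hor B -> hTransData B B)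
    (lv : Ver B -> vTransData B B) (z : Sq B) (th : Ob B -> Sq B) : Prop :=
  isModif (lh (top z)) (lh (bot z)) (lv (lft z)) (lv (rgt z)) th /\
  (forall Y, th Y = fsq (ract bn Y) z).

Definition rcentral_sq (rh : Hor B -> hTransData B B)
    (rv : Ver B -> vTransData B B) (w : Sq B) (th : Ob B -> Sq B) : Prop :=
  isModif (rh (top w)) (rh (bot w)) (rv (lft w)) (rv (rgt w)) th /\
  (forall X, th X = fsq (lact bn X) w).

End Central.

(* lh K = K \ltimes -, rh k = - \rtimes k, and likewise lv, rv for 1v-cells and
   ls, rs for squares.  The identities between the components on objects and
   the actions of the functors (e.g. X \ltimes -|_k = - \rtimes k|_X) are the
   second halves of the centrality predicates.
   The component U \ltimes -|_u has sides (X \ltimes u)/(U \ltimes Y') and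
   (U \ltimes Y)/(X' \ltimes u), so it is the oplax one, inverse to vd; the
   same holds for - \rtimes u|_U. *)
Record centralBinoidal (B : dblCat) := CentralBinoidal {
  cbin :> binoidal B;
  lh : Hor B -> hTransData B B;
  rh : Hor B -> hTransData B B;
  lv : Ver B -> vTransData B B;
  rv : Ver B -> vTransData B B;
  ls : Sq B -> Ob B -> Sq B;
  rs : Sq B -> Ob B -> Sq B;
  lh_central : forall K, lcentral_hor cbin K (lh K);
  rh_central : forall k, rcentral_hor cbin k (rh k);
  lv_central : forall U, lcentral_ver cbin U (lv U);
  rv_central : forall u, rcentral_ver cbin u (rv u);
  ls_central : forall z, lcentral_sq cbin lh lv z (ls z);
  rs_central : forall w, rcentral_sq cbin rh rv w (rs w);
  lh_rh : forall K k, hoplax (lh K) k = vinv (hoplax (rh k) K);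
  lv_rv : forall U u, voplax (lv U) u = hinv (voplax (rv u) U);
  lh_rv : forall K u, hv (lh K) u = vh (rv u) K;
  lv_rh : forall U k, vh (lv U) k = hv (rh k) U
}.

(* Bare existence of a functor A -> Pseudo(B,C) or of a quasi-functor is little
   information (constant functors, projections); the next two predicates say
   that two structures correspond, i.e. are built from the same cells:
   F(X) = H(X,-), F(K)(Y) = H(K,Y), delta_{F(K),k} = H(K,k), and so on. *)
Record sameFQ (A B C : dblCat) (F : psFunctor A (Pseudo B C))
    (H : quasiFunctor A B C) : Prop := SameFQ {
  fq_ob : forall X, fob F X = qr H X :> psFunctor B C;
  fq_hor : forall K Y, hc (hdat (fhor F K)) Y = fhor (ql H Y) K;
  fq_ver : forall U Y, vc (vdat (fver F U)) Y = fver (ql H Y) U;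
  fq_sq : forall z Y, mdat (fsq F z) Y = fsq (ql H Y) z;
  fq_cmp : forall K K' (e : hcod K = hdom K') Y,
    mdat (fcmp F e) Y = fcmp (ql H Y) e;
  fq_unt : forall X Y, mdat (funt F X) Y = funt (ql H Y) X;
  fq_hh : forall K k, hd (hdat (fhor F K)) k = qhh H K k;
  fq_hv : forall K u, hv (hdat (fhor F K)) u = qhv H K u;
  fq_vh : forall U k, vh (vdat (fver F U)) k = qvh H U k;
  fq_vv : forall U u, vd (vdat (fver F U)) u = qvv H U u
}.

(* X \ltimes - = H(X,-), - \rtimes Y = H(-,Y).  The remaining data of S are
   determined by these and the axioms of centralBinoidal. *)
Record sameQC (B : dblCat) (H : quasiFunctor B B B) (S : centralBinoidal B) :
    Prop := SameQC {
  qc_lact : forall X, lact S X = qr H X;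
  qc_ract : forall Y, ract S Y = ql H Y;
  qc_hh : forall K k, hd (lh S K) k = qhh H K k;
  qc_hv : forall K u, hv (lh S K) u = qhv H K u;
  qc_vh : forall U k, vh (lv S U) k = qvh H U k;
  qc_vv : forall U u, vd (lv S U) u = qvv H U u
}.

(* Main.v *)
(* All three structures consist of the same cells; only the axioms are grouped
   differently.  For a quasi-functor H the axioms in which the first variable is
   held fixed say that H(K,-), H(U,-) and H(zeta,-) are horizontal and vertical
   transformations and modifications, and those in which the second one is fixed
   say the same of H(-,k), H(-,u) and H(-,omega) after the interchange squares
   H(K,k) and H(U,u) have been replaced by their inverses.  Both halves together
   are the central binoidal structure.  In a functor F into Pseudo the first
   half is the well-definedness of F(K), F(U), F(zeta), and the second one says
   that F respects compositions and that its compositors and unitors are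
   modifications; H(-,Y) is F followed by evaluation at Y. *)
Require Import Defs.
From mathcomp Require Import ssreflect ssrfun ssrbool.
From mathcomp Require Import boolp.

Set Implicit Arguments.
Unset Strict Implicit.
Unset Printing Implicit Defensive.

Local Open Scope dbl_scope.

(** * Uniqueness, composition and whiskering of inverse squares *)

Section InverseSquares.
Variable D : dblCat.
Implicit Types a b x y z : Sq D.

Lemma vinverse_sym a b : vinverse a b -> vinverse b a.
Proof. by case. Qed.

Lemma hinverse_sym a b : hinverse a b -> hinverse b a.
Proof. by case. Qed.

Lemma vinverse_uniq a b b' : vinverse a b -> vinverse a b' -> b = b'.
Proof.
move=> [e1 e2 e3 e4] [e1' e2' e3' e4'].
rewrite -(vsq1E (a := b) e2) -e3' vsqA // e4 vsq1lE //; congruence.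
Qed.

Lemma hinverse_uniq a b b' : hinverse a b -> hinverse a b' -> b = b'.
Proof.
move=> [e1 e2 e3 e4] [e1' e2' e3' e4'].
rewrite -(hsq1E (a := b) e2) -e3' hsqA // e4 hsq1lE //; congruence.
Qed.

Lemma vinvP a : vinvertible a -> vinverse a (vinv a).
Proof. by rewrite /vinv; case: pselect => // h _; case: (cid h). Qed.

Lemma hinvP a : hinvertible a -> hinverse a (hinv a).
Proof. by rewrite /hinv; case: pselect => // h _; case: (cid h). Qed.

(** As [vinv] is defined by choice, an explicit inverse is identified with it only through
    uniqueness. *)
Lemma vinv_eq a b : vinverse a b -> vinv a = b.
Proof. by move=> h; apply: (vinverse_uniq _ h); apply: vinvP; exists b. Qed.

Lemma hinv_eq a b : hinverse a b -> hinv a = b.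
Proof. by move=> h; apply: (hinverse_uniq _ h); apply: hinvP; exists b. Qed.

Lemma vinvK a : vinvertible a -> vinv (vinv a) = a.
Proof. by move=> /vinvP/vinverse_sym/vinv_eq. Qed.

Lemma hinvK a : hinvertible a -> hinv (hinv a) = a.
Proof. by move=> /hinvP/hinverse_sym/hinv_eq. Qed.

Lemma vinverse_vinvertible a b : vinverse a b -> vinvertible b.
Proof. by move/vinverse_sym; exists a. Qed.

Lemma hinverse_hinvertible a b : hinverse a b -> hinvertible b.
Proof. by move/hinverse_sym; exists a. Qed.

(** Unlike [vinvertible_vsq], this keeps track of the inverse, which the swap lemmas and [hinv_eq]
    need explicitly; the same applies to the whiskered versions below. *)
Lemma vinverse_vsq a b a' b' : bot a = top b ->
  vinverse a a' -> vinverse b b' -> vinverse (a </> b) (b' </> a').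
Proof.
move=> e [ea1 ea2 ea3 ea4] [eb1 eb2 eb3 eb4].
split; [bd|bd| |].
- rewrite vsqA; [|bd..]; rewrite -(vsqA (a := a)); [|bd..].
  by rewrite eb3 vsq1E ?ea3; bd.
- rewrite vsqA; [|bd..]; rewrite -(vsqA (a := b')); [|bd..].
  by rewrite ea4 vsq1E ?eb4; bd.
Qed.

Lemma hinverse_hsq a b a' b' : rgt a = lft b ->
  hinverse a a' -> hinverse b b' -> hinverse (a <|> b) (b' <|> a').
Proof.
move=> e [ea1 ea2 ea3 ea4] [eb1 eb2 eb3 eb4].
split; [bd|bd| |].
- rewrite hsqA; [|bd..]; rewrite -(hsqA (a := a)); [|bd..].
  by rewrite eb3 hsq1E ?ea3; bd.
- rewrite hsqA; [|bd..]; rewrite -(hsqA (a := b')); [|bd..].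
  by rewrite ea4 hsq1E ?eb4; bd.
Qed.

Lemma vinverse_wr a b (f : Hor D) : rgt a = vid (hdom f) ->
  vinverse a b -> vinverse (a <|> idh f) (b <|> idh f).
Proof.
move=> ea H; have eb := vinverse_rgt H ea; case: H => e1 e2 e3 e4.
split; [bd|bd| |]; rewrite -wr //.
- by rewrite e3 -idh_hcmp ?top_hsq ?top_idh //; bd.
- by rewrite e4 -idh_hcmp ?top_hsq ?top_idh //; bd.
Qed.

Lemma vinverse_wl a b (f : Hor D) : lft a = vid (hcod f) ->
  vinverse a b -> vinverse (idh f <|> a) (idh f <|> b).
Proof.
move=> ea H; have eb := vinverse_lft H ea; case: H => e1 e2 e3 e4.
split; [bd|bd| |]; rewrite -wl //.
- by rewrite e3 -idh_hcmp ?top_hsq ?top_idh //; bd.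
- by rewrite e4 -idh_hcmp ?top_hsq ?top_idh //; bd.
Qed.

Lemma hinverse_wd a b (u : Ver D) : bot a = hid (vdom u) ->
  hinverse a b -> hinverse (a </> idv u) (b </> idv u).
Proof.
move=> ea H; have eb := hinverse_bot H ea.
have ca : vcod (lft a) = vdom u by rewrite -hdom_bot ea; bd.
have cb : vcod (lft b) = vdom u by rewrite -hdom_bot eb; bd.
case: H => e1 e2 e3 e4.
split; [bd|bd| |]; rewrite -wd //.
- by rewrite e3 -idv_vcmp ?lft_vsq ?lft_idv //; bd.
- by rewrite e4 -idv_vcmp ?lft_vsq ?lft_idv //; bd.
Qed.

Lemma hinverse_wu a b (u : Ver D) : top a = hid (vcod u) ->
  hinverse a b -> hinverse (idv u </> a) (idv u </> b).
Proof.
move=> ea H; have eb := hinverse_top H ea.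
have ca : vdom (lft a) = vcod u by rewrite -hdom_top ea; bd.
have cb : vdom (lft b) = vcod u by rewrite -hdom_top eb; bd.
case: H => e1 e2 e3 e4.
split; [bd|bd| |]; rewrite -wu //.
- by rewrite e3 -idv_vcmp ?lft_vsq ?lft_idv //; bd.
- by rewrite e4 -idv_vcmp ?lft_vsq ?lft_idv //; bd.
Qed.

(* Passing to inverses in this way turns an axiom on the interchange squares
   read in one variable into the transformation axiom in the other variable. *)
Lemma vinverse_swap a a' y y' x z : vinverse a a' -> vinverse y y' ->
  bot x = top a -> bot y = top z -> x </> a = y </> z ->
  z </> a' = y' </> x.
Proof.
move=> [a1 a2 a3 a4] [y1 y2 y3 y4] ex ez E.
have Et : top x = top y by rewrite -(top_vsq ex) E top_vsq.
have Eb : bot a = bot z by rewrite -(bot_vsq ex) E bot_vsq.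
have ez' : top z = top y' by rewrite -ez.
(* Inserting [y' </> y] above [z] gives [z = y' </> (y </> z) = y' </> (x </> a)], after which [a']
   cancels [a]. *)
rewrite -{1}(vsq1lE ez') -y4 -(vsqA (b := y)) // -E vsqA; [|bd..].
by rewrite -(vsqA (b := a)) ?a3 ?vsq1E; bd.
Qed.

Lemma hinverse_swap a a' y y' x z : hinverse a a' -> hinverse y y' ->
  rgt x = lft a -> rgt y = lft z -> x <|> a = y <|> z ->
  z <|> a' = y' <|> x.
Proof.
move=> [a1 a2 a3 a4] [y1 y2 y3 y4] ex ez E.
have Et : lft x = lft y by rewrite -(lft_hsq ex) E lft_hsq.
have Eb : rgt a = rgt z by rewrite -(rgt_hsq ex) E rgt_hsq.
have ez' : lft z = lft y' by rewrite -ez.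
rewrite -{1}(hsq1lE ez') -y4 -(hsqA (b := y)) // -E hsqA; [|bd..].
by rewrite -(hsqA (b := a)) ?a3 ?hsq1E; bd.
Qed.

End InverseSquares.

(** * Boundaries of inverses and of the cells of a quasi-functor *)

Section InvertibleBoundary.
Variable D : dblCat.
Implicit Types a : Sq D.

Lemma top_vinv a : vinvertible a -> top (vinv a) = bot a.
Proof. by case/vinvP. Qed.

Lemma bot_vinv a : vinvertible a -> bot (vinv a) = top a.
Proof. by case/vinvP. Qed.

Lemma lft_hinv a : hinvertible a -> lft (hinv a) = rgt a.
Proof. by case/hinvP. Qed.

Lemma rgt_hinv a : hinvertible a -> rgt (hinv a) = lft a.
Proof. by case/hinvP. Qed.

End InvertibleBoundary.

Section QuasiBoundary.
Variables (A B C : dblCat) (H : quasiFunctor A B C).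

(** Globularity gives the side as an identity on the domain of a composite. Objects are normalised
    to the form [fob (ql H Y) X], the direction in which [qbd] uses [qob]. *)
Lemma lft_qhh K k : lft (qhh H K k) = vid (fob (ql H (hdom k)) (hdom K)).
Proof.
by case: (qhh_glob H K k) => -> _;
  rewrite top_qhh hdom_hcmp ?hdom_fhor ?hcod_fhor ?qob.
Qed.

Lemma rgt_qhh K k : rgt (qhh H K k) = vid (fob (ql H (hcod k)) (hcod K)).
Proof.
by case: (qhh_glob H K k) => _ ->;
  rewrite top_qhh hcod_hcmp ?hdom_fhor ?hcod_fhor ?qob.
Qed.

Lemma top_qvv U u : top (qvv H U u) = hid (fob (ql H (vdom u)) (vdom U)).
Proof.
by case: (qvv_glob H U u) => -> _;
  rewrite lft_qvv vdom_vcmp ?vdom_fver ?vcod_fver ?qob.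
Qed.

Lemma bot_qvv U u : bot (qvv H U u) = hid (fob (ql H (vcod u)) (vcod U)).
Proof.
by case: (qvv_glob H U u) => _ ->;
  rewrite lft_qvv vcod_vcmp ?vdom_fver ?vcod_fver ?qob.
Qed.

Lemma lft_vinv_qhh K k :
  lft (vinv (qhh H K k)) = vid (fob (ql H (hdom k)) (hdom K)).
Proof. exact: vinverse_lft (vinvP (qhh_inv H K k)) (lft_qhh K k). Qed.

Lemma rgt_vinv_qhh K k :
  rgt (vinv (qhh H K k)) = vid (fob (ql H (hcod k)) (hcod K)).
Proof. exact: vinverse_rgt (vinvP (qhh_inv H K k)) (rgt_qhh K k). Qed.

Lemma top_hinv_qvv U u :
  top (hinv (qvv H U u)) = hid (fob (ql H (vdom u)) (vdom U)).
Proof. exact: hinverse_top (hinvP (qvv_inv H U u)) (top_qvv U u). Qed.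

Lemma bot_hinv_qvv U u :
  bot (hinv (qvv H U u)) = hid (fob (ql H (vcod u)) (vcod U)).
Proof. exact: hinverse_bot (hinvP (qvv_inv H U u)) (bot_qvv U u). Qed.

End QuasiBoundary.

(** Extends [bd_step] by the boundaries of the cells of a quasi-functor and of the inverted
    interchange squares. *)
Ltac qbd_step tac := first [ match goal with
  | |- context [fob (qr ?H ?X) ?Y] => rewrite (qob H X Y)
  | |- context [top (qhh ?H ?K ?k)] => rewrite (top_qhh H K k)
  | |- context [bot (qhh ?H ?K ?k)] => rewrite (bot_qhh H K k)
  | |- context [lft (qhh ?H ?K ?k)] => rewrite (lft_qhh H K k)
  | |- context [rgt (qhh ?H ?K ?k)] => rewrite (rgt_qhh H K k)
  | |- context [top (qhv ?H ?K ?k)] => rewrite (top_qhv H K k)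
  | |- context [bot (qhv ?H ?K ?k)] => rewrite (bot_qhv H K k)
  | |- context [lft (qhv ?H ?K ?k)] => rewrite (lft_qhv H K k)
  | |- context [rgt (qhv ?H ?K ?k)] => rewrite (rgt_qhv H K k)
  | |- context [top (qvh ?H ?K ?k)] => rewrite (top_qvh H K k)
  | |- context [bot (qvh ?H ?K ?k)] => rewrite (bot_qvh H K k)
  | |- context [lft (qvh ?H ?K ?k)] => rewrite (lft_qvh H K k)
  | |- context [rgt (qvh ?H ?K ?k)] => rewrite (rgt_qvh H K k)
  | |- context [top (qvv ?H ?K ?k)] => rewrite (top_qvv H K k)
  | |- context [bot (qvv ?H ?K ?k)] => rewrite (bot_qvv H K k)
  | |- context [lft (qvv ?H ?K ?k)] => rewrite (lft_qvv H K k)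
  | |- context [rgt (qvv ?H ?K ?k)] => rewrite (rgt_qvv H K k)
  | |- context [top (vinv (qhh ?H ?K ?k))] =>
      rewrite (top_vinv (qhh_inv H K k))
  | |- context [bot (vinv (qhh ?H ?K ?k))] =>
      rewrite (bot_vinv (qhh_inv H K k))
  | |- context [lft (vinv (qhh ?H ?K ?k))] => rewrite (lft_vinv_qhh H K k)
  | |- context [rgt (vinv (qhh ?H ?K ?k))] => rewrite (rgt_vinv_qhh H K k)
  | |- context [lft (hinv (qvv ?H ?K ?k))] =>
      rewrite (lft_hinv (qvv_inv H K k))
  | |- context [rgt (hinv (qvv ?H ?K ?k))] =>
      rewrite (rgt_hinv (qvv_inv H K k))
  | |- context [top (hinv (qvv ?H ?K ?k))] => rewrite (top_hinv_qvv H K k)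
  | |- context [bot (hinv (qvv ?H ?K ?k))] => rewrite (bot_hinv_qvv H K k)
  end | bd_step tac ].
Ltac qbd :=
  intros;
  first [ solve [reflexivity | assumption | congruence]
        | repeat (qbd_step qbd);
          solve [reflexivity | assumption | congruence] ].

(** * Transformations and modifications obtained by fixing one variable of a quasi-functor *)

Section QuasiSections.
Variables (A B C : dblCat) (H : quasiFunctor A B C).

(* The transformations H(K,-), H(U,-) and, with inverted interchange squares,
   H(-,k), H(-,u). *)
Definition qlh K : hTransData B C :=
  HTransData (fun Y => fhor (ql H Y) K) (qhv H K) (qhh H K).

Definition qlv U : vTransData B C :=
  VTransData (fun Y => fver (ql H Y) U) (qvh H U) (qvv H U).

Definition qrh k : hTransData A C :=
  HTransData (fun X => fhor (qr H X) k) (fun U => qvh H U k)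
    (fun K => vinv (qhh H K k)).

Definition qrv u : vTransData A C :=
  VTransData (fun X => fver (qr H X) u) (fun K => qhv H K u)
    (fun U => hinv (qvv H U u)).

Lemma qlhP K : isHTrans (qr H (hdom K)) (qr H (hcod K)) (qlh K).
Proof.
split=> /=; try by qbd.
- by move=> u v e; apply: qhv_vcmp.
- by move=> X; apply: qhv_vid.
- exact: qhh_inv.
- by move=> g f e; rewrite -qhh_hcmpr.
- by move=> X; apply: qhh_hidr.
- by move=> a; rewrite qhh_natr.
Qed.

Lemma qlvP U : isVTrans (qr H (vdom U)) (qr H (vcod U)) (qlv U).
Proof.
split=> /=; try by qbd.
- by move=> g f e; apply: qvh_hcmp.
- by move=> X; apply: qvh_hid.
- exact: qvv_inv.
- by move=> u v e; apply: qvv_vcmpr.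
- by move=> X; apply: qvv_vidr.
- by move=> a; apply: qvv_natr.
Qed.

Lemma qlsP z : isModif (qlh (top z)) (qlh (bot z)) (qlv (lft z)) (qlv (rgt z))
  (fun Y => fsq (ql H Y) z).
Proof.
split=> /=; try by qbd.
- by move=> k; rewrite qhh_natl.
- by move=> u; apply: qvv_natl.
Qed.

Lemma qrhP k : isHTrans (ql H (hdom k)) (ql H (hcod k)) (qrh k).
Proof.
split=> /=; try by qbd.
- by move=> U U' e; apply: qvh_vcmp.
- by move=> X; apply: qvh_vid.
- by move=> K; apply: (vinverse_vinvertible (vinvP (qhh_inv H K k))).
(* Inverting the composite of the two whiskered interchange squares reverses their order, which is
   the order required of a transformation in the first variable. *)
- move=> K' K e; apply: vinverse_swap (qhh_hcmpl H k e).
  + exact/vinvP/qhh_inv.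
  + apply: vinverse_vsq; first by qbd.
    * by apply: vinverse_wr; [qbd|apply/vinvP/qhh_inv].
    * by apply: vinverse_wl; [qbd|apply/vinvP/qhh_inv].
  + by qbd.
  + by qbd.
- move=> X.
  (* The right side of the unit axiom has no interchange square; an identity, its own inverse, is
     put in its place so that [vinverse_swap] applies. *)
  have i : vinverse (idh (fhor (qr H X) k)) (idh (fhor (qr H X) k)).
    by split; rewrite ?vsq1E //; bd.
  have E := qhh_hidl H X k.
  rewrite -[RHS](vsq1lE (f := fhor (qr H X) k)) in E; last by qbd.
  rewrite (vinverse_swap _ i _ _ E) ?vsq1lE //; try by qbd.
  exact/vinvP/qhh_inv.
- move=> z; apply: vinverse_swap (esym (qhh_natl H z k)).
  + exact/vinvP/qhh_inv.
  + exact/vinvP/qhh_inv.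
  + by qbd.
  + by qbd.
Qed.

Lemma qrvP u : isVTrans (ql H (vdom u)) (ql H (vcod u)) (qrv u).
Proof.
split=> /=; try by qbd.
- by move=> g f e; apply: qhv_hcmp.
- by move=> X; apply: qhv_hid.
- by move=> U; apply: (hinverse_hinvertible (hinvP (qvv_inv H U u))).
(* Inversion exchanges the two factors of [qvv_vcmpl], and this is the shape of [vd_vcmp]. *)
- move=> U U' e; apply: hinv_eq; rewrite qvv_vcmpl //.
  apply: hinverse_hsq; first by qbd.
  + by apply: hinverse_wu; [qbd|apply/hinvP/qvv_inv].
  + by apply: hinverse_wd; [qbd|apply/hinvP/qvv_inv].
- move=> X; rewrite qvv_vidl; apply: hinv_eq.
  by split; rewrite ?hsq1E //; bd.
- move=> z; apply/esym; apply: hinverse_swap (esym (qvv_natl H z u)).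
  + exact/hinvP/qvv_inv.
  + exact/hinvP/qvv_inv.
  + by qbd.
  + by qbd.
Qed.

Lemma qrsP w : isModif (qrh (top w)) (qrh (bot w)) (qrv (lft w)) (qrv (rgt w))
  (fun X => fsq (qr H X) w).
Proof.
split=> /=; try by qbd.
- move=> K; apply: vinverse_swap (esym (qhh_natr H K w)); try by qbd.
  + exact/vinvP/qhh_inv.
  + exact/vinvP/qhh_inv.
- move=> U; apply/esym; apply: hinverse_swap (esym (qvv_natr H U w));
    try by qbd.
  + exact/hinvP/qvv_inv.
  + exact/hinvP/qvv_inv.
Qed.

End QuasiSections.

(** * Functors into [Pseudo]: unpacking their values and evaluating at an object *)

Section Evaluation.
Variables (A B C : dblCat) (F : psFunctor A (Pseudo B C)).

(** The cell [fhor F K] stores its own source and target, which the boundary laws of [F] identify.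
    The ascriptions turn boundaries in [Pseudo] into the record fields that occur in the goal. *)
Lemma fhorP K : isHTrans (fob F (hdom K)) (fob F (hcod K)) (hdat (fhor F K)).
Proof.
have := hTransP (fhor F K).
by rewrite (hdom_fhor F K : hsrc _ = _) (hcod_fhor F K : htgt _ = _).
Qed.

Lemma fverP U : isVTrans (fob F (vdom U)) (fob F (vcod U)) (vdat (fver F U)).
Proof.
have := vTransP (fver F U).
by rewrite (vdom_fver F U : vsrc _ = _) (vcod_fver F U : vtgt _ = _).
Qed.

Lemma fsqP z : isModif (hdat (fhor F (top z))) (hdat (fhor F (bot z)))
  (vdat (fver F (lft z))) (vdat (fver F (rgt z))) (mdat (fsq F z)).
Proof.
have := modifP (fsq F z).
by rewrite (top_fsq F z : mtop _ = _) (bot_fsq F z : mbot _ = _)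
  (lft_fsq F z : mlft _ = _) (rgt_fsq F z : mrgt _ = _).
Qed.

(** Composability of the images of [f] and [g] replaces the total operation [hcmpT], which has a
    default branch, by the actual composite [hcompD]. *)
Lemma fcmpP g f (e : hcod f = hdom g) :
  isModif (hcompD (hdat (fhor F f)) (hdat (fhor F g)))
    (hdat (fhor F (g \oh f)))
    (vidD (fob F (hdom f))) (vidD (fob F (hcod g))) (mdat (fcmp F e)).
Proof.
have := modifP (fcmp F e).
rewrite (top_fcmp F e : mtop _ = _) (bot_fcmp F e : mbot _ = _)
  (lft_fcmp F e : mlft _ = _) (rgt_fcmp F e : mrgt _ = _) /= hdat_hcmpT //.
by rewrite (hcod_fhor F f : htgt _ = _) (hdom_fhor F g : hsrc _ = _) e.
Qed.

Lemma funtP X : isModif (hidD (fob F X)) (hdat (fhor F (hid X)))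
  (vidD (fob F X)) (vidD (fob F X)) (mdat (funt F X)).
Proof.
have := modifP (funt F X).
by rewrite (top_funt F X : mtop _ = _) (bot_funt F X : mbot _ = _)
  (lft_funt F X : mlft _ = _) (rgt_funt F X : mrgt _ = _).
Qed.

Lemma fver_vcmpD U U' : vcod U = vdom U' ->
  vdat (fver F (U \ov U')) = vcompD (vdat (fver F U)) (vdat (fver F U')).
Proof.
move=> e; rewrite (fver_vcmp F e : _ = vcmpT _ _) vdat_vcmpT //.
by rewrite (vcod_fver F U : vtgt _ = _) (vdom_fver F U' : vsrc _ = _) e.
Qed.

End Evaluation.

(** With the next two lemmas, evaluation at [Y] turns each equation of squares among the laws of [F]
    into one in [C]. *)
Lemma mdat_eq (B C : dblCat) (th xi : Sq (Pseudo B C)) Y :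
  th = xi -> mdat th Y = mdat xi Y.
Proof. by move=> ->. Qed.

Lemma mdat_vsq (B C : dblCat) (th xi : Sq (Pseudo B C)) Y :
  bot th = top xi -> mdat (th </> xi) Y = mdat th Y </> mdat xi Y.
Proof. exact: mdat_vsqT. Qed.

Lemma mdat_hsq (B C : dblCat) (th xi : Sq (Pseudo B C)) Y :
  rgt th = lft xi -> mdat (th <|> xi) Y = mdat th Y <|> mdat xi Y.
Proof. exact: mdat_hsqT. Qed.

Lemma vinverse_mdat (B C : dblCat) (th xi : Sq (Pseudo B C)) Y :
  vinverse th xi -> vinverse (mdat th Y) (mdat xi Y).
Proof.
move=> [e1 e2 e3 e4].
have P := modifP th; have P' := modifP xi.
split.
- by rewrite (bot_mod P) (top_mod P') (e1 : mbot th = mtop xi).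
- by rewrite (bot_mod P') (top_mod P) (e2 : mbot xi = mtop th).
- by rewrite -mdat_vsq // e3 (top_mod P).
- by rewrite -mdat_vsq // e4 (top_mod P').
Qed.

Lemma vinvertible_mdat (B C : dblCat) (th : Sq (Pseudo B C)) Y :
  vinvertible th -> vinvertible (mdat th Y).
Proof. by case=> xi /(@vinverse_mdat _ _ _ _ Y); exists (mdat xi Y). Qed.

(** The final [cbn] opens the composite and identity transformations that bound the compositors and
    unitors of [F]. *)
Ltac fbd_step tac := first [ match goal with
  | |- context [hdom (hc (hdat (fhor ?F ?K)) ?Y)] =>
      rewrite (hdom_hc (fhorP F K) Y)
  | |- context [hcod (hc (hdat (fhor ?F ?K)) ?Y)] =>
      rewrite (hcod_hc (fhorP F K) Y)
  | |- context [vdom (vc (vdat (fver ?F ?K)) ?Y)] =>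
      rewrite (vdom_vc (fverP F K) Y)
  | |- context [vcod (vc (vdat (fver ?F ?K)) ?Y)] =>
      rewrite (vcod_vc (fverP F K) Y)
  | |- context [top (mdat (fsq ?F ?K) ?Y)] => rewrite (top_mod (fsqP F K) Y)
  | |- context [bot (mdat (fsq ?F ?K) ?Y)] => rewrite (bot_mod (fsqP F K) Y)
  | |- context [lft (mdat (fsq ?F ?K) ?Y)] => rewrite (lft_mod (fsqP F K) Y)
  | |- context [rgt (mdat (fsq ?F ?K) ?Y)] => rewrite (rgt_mod (fsqP F K) Y)
  | |- context [top (mdat (fcmp ?F ?K) ?Y)] => rewrite (top_mod (fcmpP F K) Y)
  | |- context [bot (mdat (fcmp ?F ?K) ?Y)] => rewrite (bot_mod (fcmpP F K) Y)
  | |- context [lft (mdat (fcmp ?F ?K) ?Y)] => rewrite (lft_mod (fcmpP F K) Y)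
  | |- context [rgt (mdat (fcmp ?F ?K) ?Y)] => rewrite (rgt_mod (fcmpP F K) Y)
  | |- context [top (mdat (funt ?F ?K) ?Y)] => rewrite (top_mod (funtP F K) Y)
  | |- context [bot (mdat (funt ?F ?K) ?Y)] => rewrite (bot_mod (funtP F K) Y)
  | |- context [lft (mdat (funt ?F ?K) ?Y)] => rewrite (lft_mod (funtP F K) Y)
  | |- context [rgt (mdat (funt ?F ?K) ?Y)] => rewrite (rgt_mod (funtP F K) Y)
  | |- context [top (hd (hdat (fhor ?F ?K)) ?k)] =>
      rewrite (top_hd (fhorP F K) k)
  | |- context [bot (hd (hdat (fhor ?F ?K)) ?k)] =>
      rewrite (bot_hd (fhorP F K) k)
  | |- context [lft (hd (hdat (fhor ?F ?K)) ?k)] =>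
      rewrite (lft_hd (fhorP F K) k)
  | |- context [rgt (hd (hdat (fhor ?F ?K)) ?k)] =>
      rewrite (rgt_hd (fhorP F K) k)
  | |- context [top (hv (hdat (fhor ?F ?K)) ?k)] =>
      rewrite (top_hv (fhorP F K) k)
  | |- context [bot (hv (hdat (fhor ?F ?K)) ?k)] =>
      rewrite (bot_hv (fhorP F K) k)
  | |- context [lft (hv (hdat (fhor ?F ?K)) ?k)] =>
      rewrite (lft_hv (fhorP F K) k)
  | |- context [rgt (hv (hdat (fhor ?F ?K)) ?k)] =>
      rewrite (rgt_hv (fhorP F K) k)
  | |- context [top (vh (vdat (fver ?F ?K)) ?k)] =>
      rewrite (top_vh (fverP F K) k)
  | |- context [bot (vh (vdat (fver ?F ?K)) ?k)] =>
      rewrite (bot_vh (fverP F K) k)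
  | |- context [lft (vh (vdat (fver ?F ?K)) ?k)] =>
      rewrite (lft_vh (fverP F K) k)
  | |- context [rgt (vh (vdat (fver ?F ?K)) ?k)] =>
      rewrite (rgt_vh (fverP F K) k)
  | |- context [top (vd (vdat (fver ?F ?K)) ?k)] =>
      rewrite (top_vd (fverP F K) k)
  | |- context [bot (vd (vdat (fver ?F ?K)) ?k)] =>
      rewrite (bot_vd (fverP F K) k)
  | |- context [lft (vd (vdat (fver ?F ?K)) ?k)] =>
      rewrite (lft_vd (fverP F K) k)
  | |- context [rgt (vd (vdat (fver ?F ?K)) ?k)] =>
      rewrite (rgt_vd (fverP F K) k)
  end; cbn [hc hv hd vc vh vd hcompD vcompD hidD vidD] | bd_step tac ].
Ltac fbd :=
  intros;
  first [ solve [reflexivity | assumption | congruence]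
        | repeat (fbd_step fbd);
          solve [reflexivity | assumption | congruence] ].

(** * From a functor into [Pseudo] to a quasi-functor *)

Section FunctorToQuasi.
Variables (A B C : dblCat) (F : psFunctor A (Pseudo B C)).

Definition evalF (Y : Ob B) : psFunctor A C.
Proof.
apply: (@PsFunctor A C (fun X => fob (fob F X) Y)
  (fun K => hc (hdat (fhor F K)) Y) (fun U => vc (vdat (fver F U)) Y)
  (fun z => mdat (fsq F z) Y) (fun g f e => mdat (fcmp F e) Y)
  (fun X => mdat (funt F X) Y)); try by fbd.
- by move=> U U' e; rewrite fver_vcmpD.
- by move=> K; rewrite (fsq_idh F K).
- by move=> a b e; rewrite (fsq_vsq F e) mdat_vsq //; bd.
- by move=> g f e; apply: vinvertible_mdat (fcmp_inv F e).
- by move=> X; apply: vinvertible_mdat (funt_inv F X).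
- move=> a b e e' r.
  have := mdat_eq Y (fcmp_nat F e e' r).
  by rewrite !mdat_vsq ?mdat_hsq //; bd.
- move=> U; have := mdat_eq Y (funt_nat F U).
  by rewrite !mdat_vsq //; bd.
- move=> f g h e e' e1 e2.
  have := mdat_eq Y (fcmpA F e e' e1 e2).
  by rewrite !mdat_vsq ?mdat_hsq //; bd.
- move=> f e; have := mdat_eq Y (fcmp1 F e).
  by rewrite !mdat_vsq ?mdat_hsq //; bd.
- move=> f e; have := mdat_eq Y (fcmp1l F e).
  by rewrite !mdat_vsq ?mdat_hsq //; bd.
Defined.

(** This and [evalF] are transparent, so that agreement with [F] holds by conversion. *)
Definition quasi_of_functor : quasiFunctor A B C.
Proof.
apply: (@QuasiFunctor A B C (fob F) evalF (fun _ _ => erefl)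
  (fun K k => hd (hdat (fhor F K)) k) (fun K u => hv (hdat (fhor F K)) u)
  (fun U k => vh (vdat (fver F U)) k) (fun U u => vd (vdat (fver F U)) u));
  try by move=> * /=; fbd.
- by move=> K k; split; fbd.
- by move=> K k; apply: hd_inv (fhorP F K) k.
- by move=> U u; split; fbd.
- by move=> U u; apply: vd_inv (fverP F U) u.
- by move=> K Y; apply: hd_hid (fhorP F K) Y.
(* The axioms for a horizontal identity in the first variable are the two modification conditions on
   the unitor of [F], freed of the identity squares of its trivial sides. *)
- move=> X k; have := mod_hor (funtP F X) k => /=.
  by rewrite vsq1lE //; fbd.
- move=> X u; have := mod_ver (funtP F X) u => /=.
  by rewrite hsq1lE ?hsq1E; fbd.
- by move=> U Y; apply: vh_hid (fverP F U) Y.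
- by move=> K Y; apply: hv_vid (fhorP F K) Y.
- by move=> U Y; apply: vd_vid (fverP F U) Y.
- by move=> K k k' e /=; rewrite -(hd_hcmp (fhorP F K)).
(* Likewise, the modification conditions on the compositor of [F] are the axioms for horizontal
   composites in the first variable. *)
- by move=> K K' k e; apply: mod_hor (fcmpP F e) k.
- move=> K K' u e; have := mod_ver (fcmpP F e) u => /=.
  by rewrite hsq1lE ?hsq1E; fbd.
- by move=> U k k' e; apply: vh_hcmp (fverP F U) _ _ e.
- by move=> K u u' e; apply: hv_vcmp (fhorP F K) _ _ e.
(* Since [F] preserves vertical composites strictly, these two axioms are the formulas defining
   [vcompD]. *)
- by move=> U U' k e; rewrite fver_vcmpD.
- by move=> U U' u e; rewrite fver_vcmpD.
- by move=> U u u' e; apply: vd_vcmp (fverP F U) _ _ e.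
- by move=> K w /=; rewrite (hd_nat (fhorP F K)).
- by move=> z k /=; rewrite (mod_hor (fsqP F z)).
- by move=> U w; apply: vd_nat (fverP F U) w.
- by move=> z u; apply: mod_ver (fsqP F z) u.
Defined.

Lemma quasi_of_functorP : sameFQ F quasi_of_functor.
Proof. by split. Qed.

End FunctorToQuasi.

(** * From a quasi-functor to a functor into [Pseudo] *)

Section QuasiToFunctor.
Variables (A B C : dblCat).

Lemma Pseudo_sq_eq (th xi : Sq (Pseudo B C)) :
  top th = top xi -> bot th = bot xi -> lft th = lft xi -> rgt th = rgt xi ->
  mdat th =1 mdat xi -> th = xi.
Proof. exact: modif_eq. Qed.

(** Solving the modification conditions for the inverse components shows that these form a
    modification again; the identity sides make the components globular, so that whiskering respects
    their inverses. This reduces invertibility of compositors and unitors to that of their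
    components. *)
Lemma vinvertible_Pseudo (th : Sq (Pseudo B C)) (F G : Ob (Pseudo B C)) :
  lft th = vid F -> rgt th = vid G -> (forall Y, vinvertible (mdat th Y)) ->
  vinvertible th.
Proof.
case: th => al be l r th p1 p2 p3 p4 P /= el er i.
subst l r.
have q1 : hsrc al = F by []; have q2 : htgt al = G by [].
have q3 : hsrc be = F by []; have q4 : htgt be = G by [].
have H1 := hTransP al; have H2 := hTransP be.
rewrite q1 q2 in H1; rewrite q3 q4 in H2.
have V Y := vinvP (i Y).
have tV Y := top_vinv (i Y); have bV Y := bot_vinv (i Y).
have lV Y := vinverse_lft (V Y) (lft_mod P Y).
have rV Y := vinverse_rgt (V Y) (rgt_mod P Y).
have Q : isModif be al (vidD F) (vidD G) (fun Y => vinv (th Y)).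
  split=> /=.
  - by move=> Y; rewrite tV (bot_mod P).
  - by move=> Y; rewrite bV (top_mod P).
  - exact: lV.
  - exact: rV.
  - move=> f; apply/esym; apply: vinverse_swap (esym (mod_hor P f)) => /=.
    + by apply: vinverse_wr; [rewrite (rgt_mod P); bd|].
    + by apply: vinverse_wl; [rewrite (lft_mod P); bd|].
    + by bd.
    + by bd.
  - move=> u.
    (* The vertical structure squares of identity transformations are identities, so the condition
       is an equation of two vertical composites, to which [vinverse_swap] applies. *)
    have E := mod_ver P u; rewrite /= hsq1lE ?hsq1E in E;
      [|by rewrite ?rgt_vsq ?lft_vsq ?(rgt_mod P) ?(lft_mod P) /=; bd..].
    have E' := vinverse_swap (V (vcod u)) (V (vdom u)) _ _ E.
    rewrite hsq1lE ?hsq1E; [apply: E'; bd|..].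
    + rewrite rgt_vsq ?rV ?bV; bd.
    + rewrite lft_vsq ?lV ?tV; bd.
exists (@Modif B C be al (vidT F) (vidT G) _ p3 p4 p1 p2 Q); split=> //.
- apply: Pseudo_sq_eq; rewrite ?top_vsq ?bot_vsq ?lft_vsq ?rgt_vsq //=.
  + by rewrite -[vcmpT _ _]/(vid F \ov vid F) vcmp1E //= p1.
  + by rewrite -[vcmpT _ _]/(vid G \ov vid G) vcmp1E //= p2.
  + by move=> Y; rewrite mdat_vsqT //=; case: (V Y) => _ _ -> _;
      rewrite (top_mod P).
- apply: Pseudo_sq_eq; rewrite ?top_vsq ?bot_vsq ?lft_vsq ?rgt_vsq //=.
  + by rewrite -[vcmpT _ _]/(vid F \ov vid F) vcmp1E //= p3.
  + by rewrite -[vcmpT _ _]/(vid G \ov vid G) vcmp1E //= p4.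
  + by move=> Y; rewrite mdat_vsqT //=; case: (V Y) => _ _ _ ->;
      rewrite tV (bot_mod P).
Qed.

Variable H : quasiFunctor A B C.

Definition qhorT (K : Hor A) : Hor (Pseudo B C) := HTrans (qlhP H K).
Definition qverT (U : Ver A) : Ver (Pseudo B C) := VTrans (qlvP H U).

Definition qsqT (z : Sq A) : Sq (Pseudo B C).
Proof.
by apply: (@Modif B C (qhorT (top z)) (qhorT (bot z)) (qverT (lft z))
  (qverT (rgt z)) (fun Y => fsq (ql H Y) z)) (qlsP H z) => /=; bd.
Defined.

Lemma qcmp_composable (g f : Hor A) : hcod f = hdom g ->
  htgt (qhorT f) = hsrc (qhorT g).
Proof. by move=> /= ->. Qed.

(** The axioms [qhh_hcmpl] and [qhv_hcmp], read as modification conditions; [quntP] does the same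
    with [qhh_hidl] and [qhv_hid]. *)
Lemma qcmpP (g f : Hor A) (e : hcod f = hdom g) :
  isModif (hdat (hcmpT (qhorT g) (qhorT f))) (hdat (qhorT (g \oh f)))
    (vidD (qr H (hdom f))) (vidD (qr H (hcod g))) (fun Y => fcmp (ql H Y) e).
Proof.
rewrite hdat_hcmpT; last exact: qcmp_composable.
split=> /=; try by qbd.
- by move=> k; apply: qhh_hcmpl.
- by move=> u; rewrite hsq1lE ?hsq1E ?qhv_hcmp; qbd.
Qed.

Definition qcmpT (g f : Hor A) (e : hcod f = hdom g) : Sq (Pseudo B C).
Proof.
apply: (@Modif B C (hcmpT (qhorT g) (qhorT f)) (qhorT (g \oh f))
  (vidT (qr H (hdom f))) (vidT (qr H (hcod g))) _ _ _ _ _ (qcmpP e)).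
- exact: hsrc_hcmpT (qcmp_composable e).
- exact: htgt_hcmpT (qcmp_composable e).
- exact: (congr1 (qr H) (hdom_hcmp e)).
- exact: (congr1 (qr H) (hcod_hcmp e)).
Defined.

Lemma quntP (X : Ob A) : isModif (hidD (qr H X)) (hdat (qhorT (hid X)))
    (vidD (qr H X)) (vidD (qr H X)) (fun Y => funt (ql H Y) X).
Proof.
split=> /=; try by qbd.
- by move=> k; rewrite vsq1lE ?qhh_hidl; qbd.
- by move=> u; rewrite hsq1lE ?hsq1E ?qhv_hid; qbd.
Qed.

Definition quntT (X : Ob A) : Sq (Pseudo B C).
Proof.
apply: (@Modif B C (hidT (qr H X)) (qhorT (hid X))
  (vidT (qr H X)) (vidT (qr H X)) _ _ _ _ _ (quntP X)) => //.
- exact: (congr1 (qr H) (hdom_hid X)).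
- exact: (congr1 (qr H) (hcod_hid X)).
Defined.

(** Strict preservation of vertical structure requires equality of transformations; proof
    irrelevance reduces it to the components. *)
Lemma qverT_vid X : qverT (vid X) = @vid (Pseudo B C) (qr H X).
Proof.
apply: vTrans_eq; rewrite /= ?vdom_vid ?vcod_vid //.
apply: vTransData_eq => [Y|k|u] /=.
- by rewrite fver_vid qob.
- exact: qvh_vid.
- exact: qvv_vidl.
Qed.

Lemma qverT_vcmp U U' : vcod U = vdom U' ->
  qverT (U \ov U') = qverT U \ov qverT U'.
Proof.
move=> e; have e' : vtgt (qverT U) = vsrc (qverT U') by rewrite /= e.
apply: vTrans_eq; rewrite /= ?vsrc_vcmpT ?vtgt_vcmpT ?vdat_vcmpT //=.
- by rewrite vdom_vcmp.
- by rewrite vcod_vcmp.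
apply: vTransData_eq => [Y|k|u] /=.
- exact: fver_vcmp.
- exact: qvh_vcmp.
- exact: qvv_vcmpl.
Qed.

(** This and the following equations hold by computation; they are stated so that [pbd] can compute
    boundaries without unfolding [Pseudo]. *)
Lemma hdom_qhorT K : hdom (qhorT K) = qr H (hdom K).
Proof. by []. Qed.
Lemma hcod_qhorT K : hcod (qhorT K) = qr H (hcod K).
Proof. by []. Qed.
Lemma vdom_qverT U : vdom (qverT U) = qr H (vdom U).
Proof. by []. Qed.
Lemma vcod_qverT U : vcod (qverT U) = qr H (vcod U).
Proof. by []. Qed.
Lemma top_qsqT z : top (qsqT z) = qhorT (top z).
Proof. by []. Qed.
Lemma bot_qsqT z : bot (qsqT z) = qhorT (bot z).
Proof. by []. Qed.
Lemma lft_qsqT z : lft (qsqT z) = qverT (lft z).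
Proof. by []. Qed.
Lemma rgt_qsqT z : rgt (qsqT z) = qverT (rgt z).
Proof. by []. Qed.
Lemma top_qcmpT g f (e : hcod f = hdom g) :
  top (qcmpT e) = qhorT g \oh qhorT f.
Proof. by []. Qed.
Lemma bot_qcmpT g f (e : hcod f = hdom g) : bot (qcmpT e) = qhorT (g \oh f).
Proof. by []. Qed.
Lemma lft_qcmpT g f (e : hcod f = hdom g) :
  lft (qcmpT e) = @vid (Pseudo B C) (qr H (hdom f)).
Proof. by []. Qed.
Lemma rgt_qcmpT g f (e : hcod f = hdom g) :
  rgt (qcmpT e) = @vid (Pseudo B C) (qr H (hcod g)).
Proof. by []. Qed.
Lemma top_quntT X : top (quntT X) = @hid (Pseudo B C) (qr H X).
Proof. by []. Qed.
Lemma bot_quntT X : bot (quntT X) = qhorT (hid X).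
Proof. by []. Qed.
Lemma lft_quntT X : lft (quntT X) = @vid (Pseudo B C) (qr H X).
Proof. by []. Qed.
Lemma rgt_quntT X : rgt (quntT X) = @vid (Pseudo B C) (qr H X).
Proof. by []. Qed.

Ltac pbd_step tac := first [ match goal with
  | |- context [qverT (vid ?X)] => rewrite (qverT_vid X)
  | |- context [hdom (qhorT ?X)] => rewrite (hdom_qhorT X)
  | |- context [hcod (qhorT ?X)] => rewrite (hcod_qhorT X)
  | |- context [vdom (qverT ?X)] => rewrite (vdom_qverT X)
  | |- context [vcod (qverT ?X)] => rewrite (vcod_qverT X)
  | |- context [top (qsqT ?X)] => rewrite (top_qsqT X)
  | |- context [bot (qsqT ?X)] => rewrite (bot_qsqT X)
  | |- context [lft (qsqT ?X)] => rewrite (lft_qsqT X)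
  | |- context [rgt (qsqT ?X)] => rewrite (rgt_qsqT X)
  | |- context [top (qcmpT ?X)] => rewrite (top_qcmpT X)
  | |- context [bot (qcmpT ?X)] => rewrite (bot_qcmpT X)
  | |- context [lft (qcmpT ?X)] => rewrite (lft_qcmpT X)
  | |- context [rgt (qcmpT ?X)] => rewrite (rgt_qcmpT X)
  | |- context [top (quntT ?X)] => rewrite (top_quntT X)
  | |- context [bot (quntT ?X)] => rewrite (bot_quntT X)
  | |- context [lft (quntT ?X)] => rewrite (lft_quntT X)
  | |- context [rgt (quntT ?X)] => rewrite (rgt_quntT X)
  end | bd_step tac ].
Ltac pbd :=
  intros;
  first [ solve [reflexivity | assumption | congruence]
        | repeat (pbd_step pbd);
          solve [reflexivity | assumption | congruence] ].

(** Each equation between squares is checked on boundaries by [pbd] and on components at [Y], where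
    it is the same law for [ql H Y]. *)
Definition functor_of_quasi : psFunctor A (Pseudo B C).
Proof.
apply: (@PsFunctor A (Pseudo B C) (qr H) qhorT qverT qsqT qcmpT quntT) => //.
- exact: qverT_vid.
- exact: qverT_vcmp.
- by move=> f; apply: Pseudo_sq_eq => [||||Y]; [pbd..|apply: fsq_idh].
- move=> a b e; apply: Pseudo_sq_eq => [||||Y]; try by pbd.
  + have c : vcod (lft a) = vdom (lft b) by rewrite -hdom_bot e hdom_top.
    by rewrite lft_vsq ?lft_qsqT ?lft_vsq ?qverT_vcmp; pbd.
  + have c : vcod (rgt a) = vdom (rgt b) by rewrite -hcod_bot e hcod_top.
    by rewrite rgt_vsq ?rgt_qsqT ?rgt_vsq ?qverT_vcmp; pbd.
  + by rewrite mdat_vsq; [apply: fsq_vsq|pbd].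
- move=> g f e; apply: (vinvertible_Pseudo (lft_qcmpT e) (rgt_qcmpT e)) => Y.
  exact: fcmp_inv.
- move=> X; apply: (vinvertible_Pseudo (lft_quntT X) (rgt_quntT X)) => Y.
  exact: funt_inv.
- move=> a b e e' r; apply: Pseudo_sq_eq => [||||Y]; try by pbd.
  rewrite !mdat_vsq ?mdat_hsq; [exact: fcmp_nat|pbd..].
- move=> u; apply: Pseudo_sq_eq => [||||Y]; try by pbd.
  rewrite !mdat_vsq; [exact: funt_nat|pbd..].
- move=> f g h e e' e1 e2; apply: Pseudo_sq_eq => [||||Y]; try by pbd.
  rewrite !mdat_vsq ?mdat_hsq; [exact: fcmpA|pbd..].
- move=> f e; apply: Pseudo_sq_eq => [||||Y]; try by pbd.
  rewrite !mdat_vsq ?mdat_hsq; [exact: fcmp1|pbd..].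
- move=> f e; apply: Pseudo_sq_eq => [||||Y]; try by pbd.
  rewrite !mdat_vsq ?mdat_hsq; [exact: fcmp1l|pbd..].
Defined.

Lemma functor_of_quasiP : sameFQ functor_of_quasi H.
Proof. by split. Qed.

End QuasiToFunctor.

(** * From a quasi-functor to a central binoidal structure *)

Section QuasiToCentral.
Variables (B : dblCat) (H : quasiFunctor B B B).

Definition central_of_quasi : centralBinoidal B.
Proof.
apply: (@CentralBinoidal B (Binoidal (@qob _ _ _ H)) (qlh H) (qrh H) (qlv H)
  (qrv H) (fun z Y => fsq (ql H Y) z) (fun w X => fsq (qr H X) w)) => //.
- by move=> K; split=> //; apply: qlhP.
- by move=> k; split=> //; apply: qrhP.
- by move=> U; split=> //; apply: qlvP.
- by move=> u; split=> //; apply: qrvP.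
- by move=> z; split=> //; apply: qlsP.
- by move=> w; split=> //; apply: qrsP.
- by move=> K k; rewrite /hoplax /= vinvK //; apply: qhh_inv.
(* Both [voplax] components are inverses of [vd], and [vd] of [qrv] is itself an inverse; hence
   [hinv (qvv H U u)] is compared with a triple inverse. *)
- move=> U u; rewrite /voplax /= hinvK //.
  exact: hinverse_hinvertible (hinvP (qvv_inv H U u)).
Defined.

Lemma central_of_quasiP : sameQC H central_of_quasi.
Proof. by split. Qed.

End QuasiToCentral.

(** * From a central binoidal structure to a quasi-functor *)

Section CentralToQuasi.
Variables (B : dblCat) (S : centralBinoidal B).

Lemma lhP K : isHTrans (lact S (hdom K)) (lact S (hcod K)) (lh S K).
Proof. by case: (lh_central S K). Qed.
Lemma hc_lh K Y : hc (lh S K) Y = fhor (ract S Y) K.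
Proof. by case: (lh_central S K). Qed.
Lemma rhP k : isHTrans (ract S (hdom k)) (ract S (hcod k)) (rh S k).
Proof. by case: (rh_central S k). Qed.
Lemma hc_rh k X : hc (rh S k) X = fhor (lact S X) k.
Proof. by case: (rh_central S k). Qed.
Lemma lvP U : isVTrans (lact S (vdom U)) (lact S (vcod U)) (lv S U).
Proof. by case: (lv_central S U). Qed.
Lemma vc_lv U Y : vc (lv S U) Y = fver (ract S Y) U.
Proof. by case: (lv_central S U). Qed.
Lemma rvP u : isVTrans (ract S (vdom u)) (ract S (vcod u)) (rv S u).
Proof. by case: (rv_central S u). Qed.
Lemma vc_rv u X : vc (rv S u) X = fver (lact S X) u.
Proof. by case: (rv_central S u). Qed.
Lemma lsP z : isModif (lh S (top z)) (lh S (bot z)) (lv S (lft z))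
  (lv S (rgt z)) (fun Y => fsq (ract S Y) z).
Proof. by case: (ls_central S z) => P /funext <-. Qed.

Lemma vinverse_hd K k : vinverse (hd (lh S K) k) (hd (rh S k) K).
Proof.
rewrite -[hd (lh S K) k]/(hoplax _ _) lh_rh.
exact: vinverse_sym (vinvP (hd_inv (rhP k) K)).
Qed.

(** The axiom [lv_rv] compares the oplax components; cancelling a double inverse yields the relation
    between the lax ones. *)
Lemma hinverse_vd U u : hinverse (vd (lv S U) u) (vd (rv S u) U).
Proof.
have <- : hinv (vd (lv S U) u) = vd (rv S u) U.
  by rewrite -/(voplax _ _) lv_rv hinvK //; apply: vd_inv (rvP u) U.
exact: hinvP (vd_inv (lvP U) u).
Qed.

Ltac cbd_step tac := first [ match goal with
  | |- context [fob (lact ?H ?X) ?Y] => rewrite (act_ob H X Y)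
  | |- context [hc (lh S ?K) ?Y] => rewrite (hc_lh K Y)
  | |- context [hc (rh S ?K) ?Y] => rewrite (hc_rh K Y)
  | |- context [vc (lv S ?K) ?Y] => rewrite (vc_lv K Y)
  | |- context [vc (rv S ?K) ?Y] => rewrite (vc_rv K Y)
  | |- context [top (hd (lh S ?K) ?k)] => rewrite (top_hd (lhP K) k)
  | |- context [bot (hd (lh S ?K) ?k)] => rewrite (bot_hd (lhP K) k)
  | |- context [lft (hd (lh S ?K) ?k)] => rewrite (lft_hd (lhP K) k)
  | |- context [rgt (hd (lh S ?K) ?k)] => rewrite (rgt_hd (lhP K) k)
  | |- context [top (hv (lh S ?K) ?k)] => rewrite (top_hv (lhP K) k)
  | |- context [bot (hv (lh S ?K) ?k)] => rewrite (bot_hv (lhP K) k)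
  | |- context [lft (hv (lh S ?K) ?k)] => rewrite (lft_hv (lhP K) k)
  | |- context [rgt (hv (lh S ?K) ?k)] => rewrite (rgt_hv (lhP K) k)
  | |- context [top (vh (lv S ?K) ?k)] => rewrite (top_vh (lvP K) k)
  | |- context [bot (vh (lv S ?K) ?k)] => rewrite (bot_vh (lvP K) k)
  | |- context [lft (vh (lv S ?K) ?k)] => rewrite (lft_vh (lvP K) k)
  | |- context [rgt (vh (lv S ?K) ?k)] => rewrite (rgt_vh (lvP K) k)
  | |- context [top (vd (lv S ?K) ?k)] => rewrite (top_vd (lvP K) k)
  | |- context [bot (vd (lv S ?K) ?k)] => rewrite (bot_vd (lvP K) k)
  | |- context [lft (vd (lv S ?K) ?k)] => rewrite (lft_vd (lvP K) k)
  | |- context [rgt (vd (lv S ?K) ?k)] => rewrite (rgt_vd (lvP K) k)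
  | |- context [top (hd (rh S ?K) ?k)] => rewrite (top_hd (rhP K) k)
  | |- context [bot (hd (rh S ?K) ?k)] => rewrite (bot_hd (rhP K) k)
  | |- context [lft (hd (rh S ?K) ?k)] => rewrite (lft_hd (rhP K) k)
  | |- context [rgt (hd (rh S ?K) ?k)] => rewrite (rgt_hd (rhP K) k)
  | |- context [top (vd (rv S ?K) ?k)] => rewrite (top_vd (rvP K) k)
  | |- context [bot (vd (rv S ?K) ?k)] => rewrite (bot_vd (rvP K) k)
  | |- context [lft (vd (rv S ?K) ?k)] => rewrite (lft_vd (rvP K) k)
  | |- context [rgt (vd (rv S ?K) ?k)] => rewrite (rgt_vd (rvP K) k)
  end | bd_step tac ].
Ltac cbd :=
  intros;
  first [ solve [reflexivity | assumption | congruence]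
        | repeat (cbd_step cbd);
          solve [reflexivity | assumption | congruence] ].

(** The mixed cells are those of the left transformations. Units and composites in the first
    variable come from [rh] and [rv], by passing to inverses or through [lh_rv] and [lv_rh]; the
    other axioms come from [lh], [lv] and [ls]. *)
Definition quasi_of_central : quasiFunctor B B B.
Proof.
apply: (@QuasiFunctor B B B (lact S) (ract S) (act_ob S)
  (fun K k => hd (lh S K) k) (fun K u => hv (lh S K) u)
  (fun U k => vh (lv S U) k) (fun U u => vd (lv S U) u)); try by cbd.
- by move=> K k; split; cbd.
- by move=> K k; apply: hd_inv (lhP K) k.
- by move=> U u; split; cbd.
- by move=> U u; apply: vd_inv (lvP U) u.
- by move=> K Y; have := hd_hid (lhP K) Y; rewrite !hc_lh.
- move=> X k.
  have i : vinverse (idh (fhor (lact S X) k)) (idh (fhor (lact S X) k)).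
    by split; rewrite ?vsq1E //; bd.
  have E := hd_hid (rhP k) X; rewrite !hc_rh in E.
  rewrite -[RHS](vsq1lE (f := fhor (lact S X) k)) in E; last by cbd.
  rewrite (vinverse_swap _ i _ _ E) ?vsq1lE //; try by cbd.
  exact/vinverse_sym/vinverse_hd.
- by move=> X u; rewrite !lh_rv; have := vh_hid (rvP u) X; rewrite vc_rv.
- by move=> U Y; have := vh_hid (lvP U) Y; rewrite vc_lv.
- by move=> K Y; rewrite (hv_vid (lhP K)) hc_lh.
- by move=> X k; rewrite lv_rh (hv_vid (rhP k)) hc_rh.
- by move=> U Y; rewrite (vd_vid (lvP U)) vc_lv.
(* The square [vd (rv S u) (vid X)] is an identity, hence so is its unique inverse. *)
- move=> X u; have := hinverse_vd (vid X) u.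
  rewrite (vd_vid (rvP u)) vc_rv => /hinverse_sym V.
  by apply: hinverse_uniq V _; split; rewrite ?hsq1E //; bd.
- by move=> K k k' e; have := hd_hcmp (lhP K) e; rewrite !hc_lh.
- move=> K K' k e; have := hd_hcmp (rhP k) e; rewrite !hc_rh => E.
  apply: vinverse_swap E; try by cbd.
  + exact/vinverse_sym/vinverse_hd.
  + apply: vinverse_vsq; first by cbd.
    * by apply: vinverse_wl; [cbd|apply/vinverse_sym/vinverse_hd].
    * by apply: vinverse_wr; [cbd|apply/vinverse_sym/vinverse_hd].
- by move=> K K' u e; rewrite !lh_rv; apply: vh_hcmp (rvP u) _ _ e.
- by move=> U k k' e; apply: vh_hcmp (lvP U) _ _ e.
- by move=> K u u' e; apply: hv_vcmp (lhP K) _ _ e.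
- by move=> U U' k e; rewrite !lv_rh; apply: hv_vcmp (rhP k) _ _ e.
(* Both sides are inverse to the square of [rv S u] at the composite, the right one factor by
   factor, so they agree. *)
- move=> U U' u e; have := hinverse_vd (U \ov U') u.
  rewrite (vd_vcmp (rvP u)) // => /hinverse_sym V.
  apply: hinverse_uniq V _; apply: hinverse_hsq; first by cbd.
  + by apply: hinverse_wd; [cbd|apply/hinverse_sym/hinverse_vd].
  + by apply: hinverse_wu; [cbd|apply/hinverse_sym/hinverse_vd].
- by move=> U u u' e; apply: vd_vcmp (lvP U) _ _ e.
- by move=> K w; rewrite (hd_nat (lhP K)).
- by move=> z k; rewrite (mod_hor (lsP z)).
- by move=> U w; apply: vd_nat (lvP U) w.
- by move=> z u; apply: mod_ver (lsP z) u.
Defined.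

Lemma quasi_of_centralP : sameQC quasi_of_central S.
Proof. by split. Qed.

End CentralToQuasi.

Theorem theorem6p2 (B : dblCat) :
  [/\ inhabited (psFunctor B (Pseudo B B)) <-> inhabited (quasiFunctor B B B),
      inhabited (quasiFunctor B B B) <-> inhabited (centralBinoidal B),
      (forall F : psFunctor B (Pseudo B B),
         exists H : quasiFunctor B B B, sameFQ F H) /\
      (forall H : quasiFunctor B B B,
         exists F : psFunctor B (Pseudo B B), sameFQ F H),
      (forall H : quasiFunctor B B B,
         exists S : centralBinoidal B, sameQC H S) /\
      (forall S : centralBinoidal B,
         exists H : quasiFunctor B B B, sameQC H S)
    & forall (S : centralBinoidal B) (K k : Hor B) (U u : Ver B),
      [/\ hoplax (lh S K) k = hlax (rh S k) K,
          hlax (lh S K) k = hoplax (rh S k) K,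
          vlax (lv S U) u = voplax (rv S u) U
        & voplax (lv S U) u = vlax (rv S u) U]].
Proof.
split.
- split=> -[X]; constructor;
    [exact: quasi_of_functor X|exact: functor_of_quasi X].
- split=> -[X]; constructor;
    [exact: central_of_quasi X|exact: quasi_of_central X].
- split=> [F|H].
    by exists (quasi_of_functor F); apply: quasi_of_functorP.
  by exists (functor_of_quasi H); apply: functor_of_quasiP.
- split=> [H|S].
    by exists (central_of_quasi H); apply: central_of_quasiP.
  by exists (quasi_of_central S); apply: quasi_of_centralP.
(* Each of the symmetric relations [V] and [W], read in both directions, gives two of the four
   equations. *)
- move=> S K k U u; have V := vinverse_hd S K k; have W := hinverse_vd S U u.
  split.
  + by apply/esym; apply: vinv_eq (vinverse_sym V).
  + exact: vinv_eq V.
  + by apply/esym; apply: hinv_eq (hinverse_sym W).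
  + exact: hinv_eq W.
Qed.
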